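(* Let $p$ be an odd prime. Then $$\sum_{k=0}^{(p-1)/2}\frac{\binom{2k}k^3}{(-8)^k(k+1)}\equiv\begin{cases}-24y^2+2p\pmod{p^2}&\text{if } p\equiv1\pmod 4\text{ and } p=x^2+4y^2 \text{ with } x,y\in\mathbb Z,\\ \frac12R_1(p)+p\pmod{p^2}&\text{if } p\equiv 3\pmod 4.\end{cases}$$
   Context: For an odd prime $p$, $R_1(p)=(2p+2-2^{p-1})\binom{(p-1)/2}{[p/4]}^2$, where $[u]$ denotes the greatest integer not exceeding $u$. Congruences modulo $p^r$ between rational numbers with denominators prime to $p$ mean that the difference is $p^r$ times such a rational number. *)

(* Defs.v *)
From mathcomp Require Import all_boot all_order all_algebra.
Set Implicit Arguments. Unset Strict Implicit. Unset Printing Implicit Defensive.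
Import Order.TTheory GRing.Theory Num.Theory.
Local Open Scope ring_scope.

Definition rat_congr (p r : nat) (a b : rat) : Prop :=
  exists c : rat, coprime p `|denq c|%N /\ a - b = (p ^ r)%N%:R * c.

Definition R1 (p : nat) : rat :=
  (2 * p%:R + 2 - 2 ^+ p.-1) * ('C(p.-1./2, p %/ 4))%:R ^+ 2.

Definition S27 (p : nat) : rat :=
  \sum_(k < p.-1./2.+1) ('C(2 * k, k))%:R ^+ 3 / ((-8) ^+ k * (k.+1)%:R).

(* Main.v *)
(** Put n = (p-1)/2 and c_k = binom(n,k) binom(n+k,k), the coefficients of the
    Legendre polynomial f(x) = P_n(1+2x), and T = f(1), U = f'(1).  In Z/p^2 one
    has binom(2k,k)^2 = (-16)^k c_k, so the sum is congruent to the sum of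
    c_k binom(2k,k) 2^k / (k+1).  By Clausen's identity
    f(x)^2 = sum_k c_k binom(2k,k) (x(x+1))^k and the differential equation of f,
    that sum is the value at x = 1 of an antiderivative, and equals
    T^2 - 2 U^2 / (n(n+1)) = T^2 + 8 U^2 in Z/p^2.

    With a_k = binom(-1/2,k) one has c_k = (-1)^k a_k^2 in Z/p^2, while
    a_k = binom(n,k) = a_(n-k) mod p.  Hence (a_k - a_(n-k))^2 = 0, squares may be
    replaced by the products a_k a_(n-k), and the sums become coefficients of
    (1-X^2)^(-1/2): this gives T for even n, and U up to a multiple of T for odd n.
    A Wronskian of f and its reciprocal polynomial yields the Legendre-type relation
    T (T + 4U) = (-1)^n p, which supplies the missing quantity in both cases.

    For p = 1 mod 4 it remains to see that T^2 + 2p = 4x^2.  Jacobsthal's identity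
    shows that J = sum_t (t(t^2-1)/p) satisfies J^2 = 4x^2.  On Teichmueller
    representatives the Legendre symbol is a polynomial mod p^2, and summing over
    them gives 2J = -2T + (-1)^m binom(6m,3m) with p = 4m+1, where
    (-1)^m T binom(6m,3m) = -2p. *)

Require Import Defs.
From mathcomp Require Import all_boot all_order all_algebra.
From mathcomp Require Import fingroup cyclic finfield zify ring.
Set Implicit Arguments. Unset Strict Implicit. Unset Printing Implicit Defensive.
Import Order.TTheory GRing.Theory Num.Theory.
Local Open Scope ring_scope.

(** * Clausen's identity for Legendre polynomials *)

Lemma horner_deriv_poly (R : nzSemiRingType) (N : nat) (E : nat -> R) (x : R) :
  (\poly_(k < N) E k)^`().[x] = \sum_(k < N) (E k *+ k) * x ^+ k.-1.
Proof.
rewrite poly_def raddf_sum horner_sum; apply: eq_bigr => k _ /=.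
by rewrite derivZ derivXn hornerZ hornerMn hornerXn mulrnAr mulrnAl.
Qed.

(** * The third-order equation satisfied by squares of Legendre polynomials *)

Section SymmetricSquare.
Variables (M : nat) (q : {poly rat}).
Local Notation PQ := {poly rat}.
Local Notation N := (M%:R).
Hypothesis dq2 : q^`() ^+ 2 = 1 + 4%:R * q.
Hypothesis ddq : q^`()^`() = 2%:R.

(* The symmetric square of the equation [(q * f')' = N * f]. *)
Definition square_ode (y : PQ) : PQ :=
  q ^+ 2 * y^`()^`()^`() + 3%:R * q * q^`() * y^`()^`()
  + (q^`() ^+ 2 + 2%:R * q - 4%:R * N * q) * y^`() - 2%:R * N * q^`() * y.

Lemma square_odeB (y z : PQ) : square_ode (y - z) = square_ode y - square_ode z.
Proof. by rewrite /square_ode !derivB; ring. Qed.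

Lemma deriv_nat (k : nat) : (k%:R : PQ)^`() = 0.
Proof. by rewrite -polyC_natr derivC. Qed.

(** The operator applied to [f ^+ 2] is a combination of the equation of [f] ([e0]) and of its
    derivative ([e1]), with coefficients [6 q f' + 2 q' f] and [2 q f]. *)
Lemma square_ode_sqr (f : PQ) :
  (q * f^`())^`() = N * f -> square_ode (f ^+ 2) = 0.
Proof.
move=> ode; have e0 : q * f^`()^`() + q^`() * f^`() - N * f = 0.
  by rewrite -ode derivM; ring.
have e1 : q * f^`()^`()^`() + 2%:R * q^`() * f^`()^`() + 2%:R * f^`() - N * f^`() = 0.
  have := congr1 (fun u : PQ => u^`()) e0.
  rewrite !(derivB, derivD, derivM) ddq deriv_nat deriv0 => <-.
  by ring.
rewrite /square_ode expr2 !(derivM, derivD).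
transitivity (2%:R * q * f * (q * f^`()^`()^`() + 2%:R * q^`() * f^`()^`()
    + 2%:R * f^`() - N * f^`())
  + (6%:R * q * f^`() + 2%:R * q^`() * f) * (q * f^`()^`() + q^`() * f^`() - N * f)).
  by ring.
by rewrite e0 e1 !mulr0 addr0.
Qed.

(** By the chain rule with [q'^2 = 1 + 4 q] and [q'' = 2], the operator applied to [G \Po q] is [q']
    times the hypothesis on [G] evaluated at [q]. *)
Lemma square_ode_comp (G : PQ) :
  'X ^+ 2 * (1 + 4%:R * 'X) * G^`()^`()^`()
  + (3%:R * 'X + 18%:R * 'X ^+ 2) * G^`()^`()
  + (1 + 12%:R * 'X - 4%:R * N * 'X) * G^`() - 2%:R * N * G = 0 ->
  square_ode (G \Po q) = 0.
Proof.
move=> /(congr1 (fun u => u \Po q)).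
rewrite comp_poly0 !(comp_polyB, comp_polyD, comp_polyM, comp_Xn_poly, comp_polyX).
rewrite -!polyC_natr !comp_polyC !polyC_natr => e.
rewrite /square_ode !deriv_comp !derivM !deriv_comp !derivD !derivM !deriv_comp ddq deriv_nat.
move: e; set y := G \Po q; set y1 := G^`() \Po q.
set y2 := G^`()^`() \Po q; set y3 := G^`()^`()^`() \Po q => e.
transitivity (q^`() * (q ^+ 2 * (q^`() ^+ 2 * y3 + 6%:R * y2)
  + 3%:R * q * (q^`() ^+ 2 * y2 + 2%:R * y1)
  + (q^`() ^+ 2 + 2%:R * q - 4%:R * N * q) * y1 - 2%:R * N * y)); first by ring.
by rewrite dq2 -[RHS](mulr0 q^`()) -e; ring.
Qed.

End SymmetricSquare.

Section Clausen.

(* The coefficient of [x ^ k] in the Legendre polynomial [P_n(1 + 2x)]. *)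
Definition leg_coef (n k : nat) : nat := 'C(n, k) * 'C(n + k, k).

Lemma leg_coefS (n k : nat) :
  (k.+1 ^ 2 * leg_coef n k.+1 = (n - k) * (n + k + 1) * leg_coef n k)%N.
Proof.
have h1 : (k.+1 * 'C(n, k.+1) = (n - k) * 'C(n, k))%N by rewrite mul_bin_left.
have h2 : (k.+1 * 'C(n + k.+1, k.+1) = (n + k + 1) * 'C(n + k, k))%N.
  by rewrite addnS -mul_bin_diag addn1.
rewrite /leg_coef; transitivity ((k.+1 * 'C(n, k.+1)) * (k.+1 * 'C(n + k.+1, k.+1)))%N.
  by ring.
by rewrite h1 h2; ring.
Qed.

Lemma leg_coef0 (n : nat) : leg_coef n 0 = 1%N.
Proof. by rewrite /leg_coef !bin0. Qed.

Lemma leg_coef_small (n k : nat) : (n < k)%N -> leg_coef n k = 0%N.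
Proof. by move=> nk; rewrite /leg_coef bin_small. Qed.

(** Writing [(n - k)(n + k + 1)] as [n (n + 1) - k (k + 1)] removes the truncated subtraction, so
    the recurrence passes to any commutative ring. *)
Lemma leg_coefS_ring (R : comPzRingType) (n k : nat) :
  (k.+1%:R ^+ 2 * (leg_coef n k.+1)%:R =
   ((n * n.+1)%:R - (k * k.+1)%:R) * (leg_coef n k)%:R :> R).
Proof.
case: (leqP k n) => kn; last first.
  by rewrite !leg_coef_small ?mulr0 //; apply: ltnW.
have := congr1 (fun i => i%:R : R) (leg_coefS n k).
rewrite !natrM -expr2 => ->; congr (_ * _).
rewrite natrB // !natrD -!natr1; ring.
Qed.

Lemma double_binS (k : nat) :
  (k.+1 * 'C(2 * k.+1, k.+1) = 2 * (2 * k + 1) * 'C(2 * k, k))%N.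
Proof.
have h1 : (k.+1 * 'C(2 * k.+1, k.+1) = 2 * k.+1 * 'C((2 * k).+1, k))%N.
  by rewrite -mul_bin_diag; congr (_ * 'C(_, _))%N; lia.
have h2 : (k.+1 * 'C((2 * k).+1, k) = (2 * k + 1) * 'C(2 * k, k))%N.
  rewrite addn1 mul_bin_down; congr (_ * _)%N; lia.
by rewrite h1 -mulnA h2 mulnA.
Qed.

Variable n : nat.
Local Notation PQ := {poly rat}.
Local Notation N := ((n * n.+1)%:R).

Let f : PQ := \poly_(k < n.+1) (leg_coef n k)%:R.
Let g (k : nat) : rat := (leg_coef n k)%:R * ('C(2 * k, k))%:R.
Let G : PQ := \poly_(k < n.+1) g k.
Let q : PQ := 'X ^+ 2 + 'X.

Let coef_f k : f`_k = (leg_coef n k)%:R.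
Proof. by rewrite coef_poly ltnS; case: leqP => // ?; rewrite leg_coef_small. Qed.

Let coef_G k : G`_k = g k.
Proof. by rewrite coef_poly ltnS; case: leqP => // ?; rewrite /g leg_coef_small // mul0r. Qed.

Let dq : q^`() = 'X *+ 2 + 1.
Proof. by rewrite /q derivD derivXn derivX. Qed.

Let ddq : q^`()^`() = 2%:R.
Proof. by rewrite dq derivD derivMn derivX derivC addr0. Qed.

Lemma legendre_ode : (q * f^`())^`() = N * f.
Proof.
apply/polyP => k; rewrite coef_deriv mulr_natl coefMn /q mulrDl.
rewrite coefD coefXnM coefXM !coef_deriv !coef_f.
have h : N * (leg_coef n k)%:R
    = k.+1%:R ^+ 2 * (leg_coef n k.+1)%:R + (k * k.+1)%:R * (leg_coef n k)%:R :> rat.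
  by rewrite leg_coefS_ring; ring.
by rewrite -[RHS]mulr_natl h; case: k {h} => [|k] /=; rewrite ?subSS ?subn0; ring.
Qed.

Let dq2 : q^`() ^+ 2 = 1 + 4%:R * q.
Proof. by rewrite dq /q; ring. Qed.

(** Coefficientwise this is [(k+1)^3 g_(k+1) = 2 (2k+1) (N - k (k+1)) g_k], the product of the
    recurrences of [leg_coef] and of the central binomial coefficients. *)
Let G_ode :
  'X ^+ 2 * (1 + 4%:R * 'X) * G^`()^`()^`()
  + (3%:R * 'X + 18%:R * 'X ^+ 2) * G^`()^`()
  + (1 + 12%:R * 'X - 4%:R * N * 'X) * G^`() - 2%:R * N * G = 0.
Proof.
apply/polyP => k.
have -> : 'X ^+ 2 * (1 + 4%:R * 'X) * G^`()^`()^`()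
  + (3%:R * 'X + 18%:R * 'X ^+ 2) * G^`()^`()
  + (1 + 12%:R * 'X - 4%:R * N * 'X) * G^`() - 2%:R * N * G
  = 'X^2 * G^`()^`()^`() + 3%:R * ('X * G^`()^`()) + G^`()
    + (4%:R * ('X^3 * G^`()^`()^`()) + 18%:R * ('X^2 * G^`()^`())
       + 12%:R * ('X * G^`()) - 4%:R * (N * ('X * G^`())) - 2%:R * (N * G)).
  by ring.
rewrite !mulr_natl !(coefD, coefB, coefN, coefMn) !coefXnM !coefXM !coef_deriv !coef_G coef0.
have h : k.+1%:R ^+ 3 * g k.+1
       = (2 * (2 * k + 1))%:R * (N - (k * k.+1)%:R) * g k.
  have h1 := leg_coefS_ring rat n k.
  have h2 : k.+1%:R * 'C(2 * k.+1, k.+1)%:R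
      = (2 * (2 * k + 1))%:R * 'C(2 * k, k)%:R :> rat by rewrite -!natrM double_binS.
  rewrite /g; transitivity ((k.+1%:R ^+ 2 * (leg_coef n k.+1)%:R)
    * (k.+1%:R * 'C(2 * k.+1, k.+1)%:R) : rat); first by ring.
  by rewrite h1 h2; ring.
have {h} : k.+1%:R ^+ 3 * g k.+1
       - (2 * (2 * k + 1))%:R * (N - (k * k.+1)%:R) * g k = 0 by rewrite h subrr.
move=> h; rewrite -[RHS]h; case: k {h} => [|[|[|k]]] /=; rewrite ?subSS ?subn0; ring.
Qed.

(* The lowest coefficient of [square_ode z] is [j ^ 3 * z`_j] for the lowest
   nonzero coefficient [z`_j] of [z]. *)
Lemma square_ode_unique (z : PQ) : square_ode (n * n.+1) q z = 0 -> z`_0 = 0 -> z = 0.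
Proof.
move=> zode z0; suff H : forall k i, (i <= k)%N -> z`_i = 0.
  by apply/polyP => i; rewrite coef0 (H i).
elim=> [|k IH] i; first by rewrite leqn0 => /eqP ->.
rewrite leq_eqVlt ltnS => /orP[/eqP ->|/IH//] {i}.
have := congr1 (fun u : PQ => u`_k) zode.
have -> : square_ode (n * n.+1) q z = 'X^2 * z^`()^`()^`() + 3%:R * ('X * z^`()^`()) + z^`()
  + (2%:R * ('X^3 * z^`()^`()^`()) + 'X^4 * z^`()^`()^`()
  + 6%:R * ('X^3 * z^`()^`()) + 9%:R * ('X^2 * z^`()^`())
  + 6%:R * ('X * z^`() + 'X^2 * z^`()) - 4%:R * (N * ('X * z^`() + 'X^2 * z^`()))
  - 2%:R * (N * (2%:R * ('X * z) + z))).
  by rewrite /square_ode dq /q; ring.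
(* In degree [k] every term apart from [(k+1)^3 z_(k+1)] involves only coefficients of index at most
   [k], which vanish by induction. *)
rewrite !mulr_natl !(coefD, coefB, coefN, coefMn) !coefXnM !coefXM !coef_deriv coef0.
have small i : (i <= k)%N -> z`_i = 0 by apply: IH.
have -> : z`_k = 0 by apply: small.
have -> : (if k == 0%N then 0 else z`_k.-1.+1 *+ k.-1.+1) = 0 :> rat.
  by case: k small {IH} => //= k -> //; rewrite mul0rn.
have -> : (if k == 0%N then 0 else z`_k.-1) = 0 :> rat.
  by case: k small {IH} => //= k ->.
have -> : (if (k < 2)%N then 0 else z`_(k - 2).+1 *+ (k - 2).+1) = 0 :> rat.
  by case: ltnP => // k2; rewrite small ?mul0rn //; lia.
have -> : (if (k < 2)%N then 0 else z`_(k - 2).+2 *+ (k - 2).+2 *+ (k - 2).+1) = 0 :> rat.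
  by case: ltnP => // k2; rewrite small ?mul0rn //; lia.
have -> : (if (k < 3)%N then 0 else z`_(k - 3).+2 *+ (k - 3).+2 *+ (k - 3).+1) = 0 :> rat.
  by case: ltnP => // k2; rewrite small ?mul0rn //; lia.
have -> : (if (k < 3)%N then 0
   else z`_(k - 3).+3 *+ (k - 3).+3 *+ (k - 3).+2 *+ (k - 3).+1) = 0 :> rat.
  by case: ltnP => // k2; rewrite small ?mul0rn //; lia.
have -> : (if (k < 4)%N then 0
   else z`_(k - 4).+3 *+ (k - 4).+3 *+ (k - 4).+2 *+ (k - 4).+1) = 0 :> rat.
  by case: ltnP => // k2; rewrite small ?mul0rn //; lia.
move=> h; have {h} : k.+1%:R ^+ 3 * z`_k.+1 = 0.
  rewrite -[RHS]h; case: k {IH small h} => [|[|k]] /=; rewrite ?subSS ?subn0; ring.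
by move/eqP; rewrite mulf_eq0 expf_eq0 /= pnatr_eq0 /= => /eqP.
Qed.

(** Both sides solve [square_ode] and have constant coefficient 1, so uniqueness applies to their
    difference. *)
Lemma legendre_clausen : f ^+ 2 = G \Po q.
Proof.
apply/eqP; rewrite -subr_eq0; apply/eqP; apply: square_ode_unique.
  rewrite square_odeB (square_ode_sqr ddq legendre_ode).
  by rewrite (square_ode_comp dq2 ddq G_ode) subr0.
rewrite -horner_coef0 hornerD hornerN horner_exp horner_comp.
have -> : q.[0] = 0 by rewrite /q !hornerE.
by rewrite !horner_coef0 coef_f coef_G /g leg_coef0 bin0; ring.
Qed.

(** The antiderivative of [G] vanishing at 0: the coefficient for [k = 0] is a division by zero,
    hence 0. *)
Let H : PQ := \poly_(k < n.+2) (g k.-1 / k%:R).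

Let dH : H^`() = G.
Proof.
apply/polyP => k; rewrite coef_deriv coef_poly coef_G ltnS ltnS /=.
case: leqP => kn; last by rewrite mul0rn /g leg_coef_small // mul0r.
by rewrite -[LHS]mulr_natr divfK ?pnatr_eq0.
Qed.

Lemma deriv0_const (z : PQ) : z^`() = 0 -> z = (z`_0)%:P.
Proof.
move=> dz; apply/polyP => -[|k]; rewrite coefC //=.
have := congr1 (fun u : PQ => u`_k) dz; rewrite coef_deriv coef0 => /eqP.
by rewrite -mulr_natr mulf_eq0 pnatr_eq0 orbF => /eqP.
Qed.

(** Both sides vanish at 0 and have derivative [N q' f^2]: on the left by Clausen's identity, on the
    right because [(q f')' = N f] cancels the terms in [f f']. *)
Let integrated : N * (H \Po q) = N * q * f ^+ 2 - (q * f^`()) ^+ 2.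
Proof.
apply/eqP; rewrite -subr_eq0; apply/eqP.
set z := _ - _; have z0 : z`_0 = 0.
  rewrite /z -horner_coef0 hornerD hornerN hornerM horner_comp.
  have q0 : q.[0] = 0 by rewrite /q !hornerE.
  have H0 : H.[0] = 0 by rewrite horner_coef0 coef_poly /= invr0 mulr0.
  rewrite q0 H0 mulr0 add0r hornerD hornerN !hornerM q0.
  by ring.
rewrite (@deriv0_const z) ?z0 //.
have e := legendre_ode; rewrite /z; move: e; set h := q * f^`() => e.
have hE : h = q * f^`() by []; clearbody h.
rewrite !derivB !expr2 !derivM deriv_nat deriv_comp e dH -legendre_clausen hE.
by ring.
Qed.

(** This is [integrated] at [x = 1], where [q] takes the value 2. *)
Lemma legendre_integral :
  N * \sum_(k < n.+1) ((leg_coef n k)%:R * 'C(2 * k, k)%:R * 2%:R ^+ k.+1 / k.+1%:R)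
  = 2%:R * N * (\sum_(k < n.+1) (leg_coef n k)%:R) ^+ 2
    - 4%:R * (\sum_(k < n.+1) (k * leg_coef n k)%:R) ^+ 2 :> rat.
Proof.
have := congr1 (fun u : PQ => u.[1]) integrated.
have q1 : q.[1] = 2%:R by rewrite /q !hornerE expr1n.
have f1 : f.[1] = \sum_(k < n.+1) (leg_coef n k)%:R.
  by rewrite horner_poly; apply: eq_bigr => k _; rewrite expr1n mulr1.
have df1 : f^`().[1] = \sum_(k < n.+1) (k * leg_coef n k)%:R.
  by rewrite horner_deriv_poly; apply: eq_bigr => k _; rewrite expr1n mulr1 natrM mulrC mulr_natr.
have H2 : H.[2%:R] = \sum_(k < n.+1) ((leg_coef n k)%:R * 'C(2 * k, k)%:R * 2%:R ^+ k.+1 / k.+1%:R).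
  rewrite horner_poly big_ord_recl /= invr0 mulr0 mul0r add0r.
  by apply: eq_bigr => k _; rewrite /= /bump /= add1n mulrAC.
rewrite hornerD hornerN !expr2 !hornerM horner_comp -!polyC_natr !hornerC.
rewrite q1 f1 df1 H2 => ->; ring.
Qed.

End Clausen.

(** * Binomial sums *)

Lemma natr_binS (S : comPzRingType) (N k : nat) :
  k.+1%:R * 'C(N, k.+1)%:R = (N%:R - k%:R) * 'C(N, k)%:R :> S.
Proof.
case: (leqP k N) => kN; last by rewrite !bin_small ?mulr0 //; apply: ltnW.
by rewrite -natrB // -!natrM mul_bin_left.
Qed.

Lemma coef_expr1D (S : comNzRingType) (N k : nat) (c : S) :
  ((1 + c *: 'X) ^+ N)`_k = c ^+ k * 'C(N, k)%:R.
Proof.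
have -> : (1 + c *: 'X) ^+ N = \poly_(i < N.+1) (c ^+ i * 'C(N, i)%:R).
  rewrite addrC exprD1n poly_def; apply: eq_bigr => i _.
  by rewrite exprZn scalerMnl mulr_natr.
by rewrite coef_poly ltnS; case: leqP => // Nk; rewrite bin_small ?mulr0.
Qed.

Lemma coef_1subX2 (S : comNzRingType) (N k : nat) :
  ((1 - 'X ^+ 2 : {poly S}) ^+ N)`_k
  = if odd k then 0 else (-1) ^+ k./2 * 'C(N, k./2)%:R.
Proof.
have -> : (1 - 'X ^+ 2 : {poly S}) ^+ N = ((1 + (-1) *: 'X) ^+ N) \Po 'X^2.
  by rewrite rmorphXn /= comp_polyD comp_polyZ comp_polyX comp_polyC scaleN1r.
by rewrite coef_comp_poly_Xn // dvdn2 divn2 coef_expr1D; case: odd.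
Qed.

(** The coefficient of degree [k] in [(1 - X)^N (1 + X)^N = (1 - X^2)^N]. *)
Lemma alternating_conv (S : comNzRingType) (N k : nat) :
  \sum_(i < k.+1) (-1) ^+ i * 'C(N, i)%:R * 'C(N, k - i)%:R
  = if odd k then 0 else (-1) ^+ k./2 * 'C(N, k./2)%:R :> S.
Proof.
rewrite -coef_1subX2.
have -> : (1 - 'X ^+ 2 : {poly S}) = (1 + (-1) *: 'X) * (1 + 1 *: 'X).
  by rewrite scaleN1r scale1r; ring.
rewrite exprMn coefM; apply: eq_bigr => i _.
by rewrite !coef_expr1D expr1n mul1r.
Qed.

(** The weight is absorbed by [i binom(N+1, i) = (N+1) binom(N, i-1)]; what remains is the
    coefficient of degree [2m] in [(1 - X)^N (1 + X)^(N+1) = (1 + X)(1 - X^2)^N]. *)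
Lemma alternating_conv_weighted (S : comNzRingType) (N m : nat) :
  \sum_(i < m.*2.+2) i%:R * (-1) ^+ i * 'C(N.+1, i)%:R * 'C(N.+1, m.*2.+1 - i)%:R
  = - N.+1%:R * (-1) ^+ m * 'C(N, m)%:R :> S.
Proof.
rewrite big_ord_recl !mul0r add0r.
transitivity (- N.+1%:R *
    \sum_(i < m.*2.+1) (-1) ^+ i * 'C(N, i)%:R * 'C(N.+1, m.*2 - i)%:R : S).
  rewrite mulr_sumr; apply: eq_bigr => i _; rewrite /= /bump /= add1n subSS exprS.
  have e : i.+1%:R * 'C(N.+1, i.+1)%:R = N.+1%:R * 'C(N, i)%:R :> S.
    by rewrite -!natrM mul_bin_diag.
  transitivity (- (-1) ^+ i * (i.+1%:R * 'C(N.+1, i.+1)%:R) * 'C(N.+1, m.*2 - i)%:R : S).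
    by ring.
  by rewrite e; ring.
rewrite -mulrA; congr (_ * _).
transitivity (((1 + (-1) *: 'X) ^+ N * (1 + 1 *: 'X) ^+ N.+1 : {poly S})`_(m.*2)).
  by rewrite coefM; apply: eq_bigr => i _; rewrite !coef_expr1D expr1n mul1r.
have -> : (1 + (-1) *: 'X) ^+ N * (1 + 1 *: 'X) ^+ N.+1
    = (1 - 'X ^+ 2 : {poly S}) ^+ N + 'X * (1 - 'X ^+ 2) ^+ N.
  have -> : (1 - 'X ^+ 2 : {poly S}) = (1 + (-1) *: 'X) * (1 + 1 *: 'X).
    by rewrite scaleN1r scale1r; ring.
  by rewrite exprMn exprS scale1r; ring.
rewrite coefD coefXM !coef_1subX2 odd_double doubleK.
by case: m => [|m] /=; rewrite ?addr0 // odd_double addr0.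
Qed.

Lemma signr_subn (S : pzRingType) (N k : nat) :
  (k <= N)%N -> (-1) ^+ (N - k) = (-1) ^+ N * (-1) ^+ k :> S.
Proof. by move=> kN; rewrite -{2}(subnK kN) exprD -mulrA -expr2 sqrr_sign mulr1. Qed.

Lemma sum_ord_rev (V : nmodType) (N : nat) (F : nat -> V) :
  \sum_(k < N.+1) F k = \sum_(k < N.+1) F (N - k)%N.
Proof.
rewrite (reindex_inj rev_ord_inj) /=; apply: eq_bigr => k _.
by rewrite subSS.
Qed.

(** The Euler operator, locked so that it stays opaque; it multiplies the coefficient of degree [k]
    by [k]. *)
Definition theta (S : nzSemiRingType) (u : {poly S}) : {poly S} := locked ('X * u^`()).

Lemma thetaE (S : nzSemiRingType) (u : {poly S}) : theta u = 'X * u^`().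
Proof. by rewrite /theta -lock. Qed.

Lemma coef_theta (S : nzSemiRingType) (u : {poly S}) (k : nat) :
  (theta u)`_k = k%:R * u`_k.
Proof.
by rewrite thetaE coefXM coef_deriv mulr_natl; case: k => [|k]; rewrite ?mulr0n.
Qed.

Lemma thetaM (S : comNzRingType) (u v : {poly S}) :
  theta (u * v) = theta u * v + u * theta v.
Proof. by rewrite !thetaE derivM; ring. Qed.

Lemma thetaB (S : comNzRingType) (u v : {poly S}) :
  theta (u - v) = theta u - theta v.
Proof. by rewrite !thetaE derivB; ring. Qed.

Lemma theta_nat (S : comNzRingType) (k : nat) : theta (k%:R : {poly S}) = 0.
Proof. by rewrite !thetaE -polyC_natr derivC mulr0. Qed.

Lemma thetaX (S : comNzRingType) : theta 'X = 'X :> {poly S}.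
Proof. by rewrite !thetaE derivX mulr1. Qed.

Lemma theta_poly (S : comNzRingType) (N : nat) (E : nat -> S) :
  theta (\poly_(k < N) E k) = \poly_(k < N) (k%:R * E k).
Proof.
by apply/polyP => k; rewrite coef_theta !coef_poly; case: ltnP; rewrite ?mulr0.
Qed.

(** * Jacobsthal sums *)

Section Jacobsthal.
Variables (p n : nat).
Hypothesis p_pr : prime p.
Hypothesis pE : p = n.*2.+1.
Local Notation F := 'F_p.

Lemma Fp_natr_eq0 (k : nat) : ((k%:R : F) == 0) = (p %| k)%N.
Proof. by rewrite (dvdn_pcharf (pchar_Fp p_pr)). Qed.

Lemma Fp_m1_neq1 : (-1 : F) != 1.
Proof.
rewrite eq_sym -subr_eq0 opprK (_ : 1 + 1 = 2%:R) // Fp_natr_eq0.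
by rewrite dvdn_prime2 // pE; apply/negP => /eqP; case: (n).
Qed.

Lemma half_gt0 : (0 < n)%N.
Proof. by have := prime_gt1 p_pr; rewrite pE; case: (n). Qed.

Lemma Fp_exp_half (x : F) : x != 0 -> x ^+ n = 1 \/ x ^+ n = -1.
Proof.
move=> x0; have e : x ^+ n.*2 = 1.
  apply: (mulfI x0); rewrite mulr1 -exprS -pE -[RHS]expf_card card_Fp //.
have : (x ^+ n) ^+ 2 == 1 by rewrite -exprM muln2 e.
by rewrite sqrf_eq1 => /orP[] /eqP ->; [left|right].
Qed.

Definition legendre (x : F) : int :=
  if x == 0 then 0 else if x ^+ n == 1 then 1 else -1.
Local Notation rho := legendre.

Lemma legendre0 : rho 0 = 0. Proof. by rewrite /rho eqxx. Qed.

Lemma legendreM (x y : F) : rho (x * y) = rho x * rho y.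
Proof.
rewrite /rho mulf_eq0; case: eqP => [|/eqP x0]; first by rewrite mul0r.
case: eqP => [|/eqP y0] /=; first by rewrite mulr0.
rewrite exprMn; have := Fp_m1_neq1 => /negPf m1.
by case: (Fp_exp_half x0) => ->; case: (Fp_exp_half y0) => ->;
  rewrite ?(mulr1, mul1r, mulrNN) ?eqxx ?m1.
Qed.

Lemma legendre_sqr (x : F) : rho (x ^+ 2) = (x != 0)%:R.
Proof.
by rewrite expr2 legendreM /rho; case: eqP => //= _; case: ifP.
Qed.

Lemma legendre_cases (x : F) : x != 0 -> rho x = 1 \/ rho x = -1.
Proof. by move=> /negPf x0; rewrite /rho x0; case: ifP; [left|right]. Qed.

Lemma legendre_exp (x : F) : x != 0 ->
  (rho x = 1 /\ x ^+ n = 1) \/ (rho x = -1 /\ x ^+ n = -1).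
Proof.
move=> x0; rewrite /rho (negPf x0); case: (Fp_exp_half x0) => ->.
  by rewrite eqxx; left.
by rewrite (negPf Fp_m1_neq1); right.
Qed.

Lemma Fp_primitive_root : exists z : F, n.*2.-primitive_root z.
Proof.
have : has n.*2.-primitive_root (enum [pred x : F | x != 0]).
  apply: has_prim_root; first by rewrite double_gt0 half_gt0.
  - apply/allP => x; rewrite mem_enum inE => x0; apply/unity_rootP.
    by case: (Fp_exp_half x0) => e; rewrite -muln2 exprM e ?expr1n // sqrrN expr1n.
  - exact: enum_uniq.
  - rewrite -cardE; have := cardC1 (0 : F); rewrite card_Fp // pE /= => e.
    by rewrite -[X in (X <= _)%N]e; apply: eq_leq; apply: eq_card => x; rewrite !inE.
by case/hasP => z _ zP; exists z.
Qed.

Section PrimitiveRoot.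
Variable z : F.
Hypothesis zP : n.*2.-primitive_root z.

Let z0 : z != 0.
Proof.
apply/eqP => z0; have := prim_expr_order zP; rewrite z0 expr0n double_eq0.
by rewrite eqn0Ngt half_gt0 => /eqP; rewrite eq_sym oner_eq0.
Qed.

Lemma prim_exp_half : z ^+ n = -1.
Proof.
case: (Fp_exp_half z0) => // /eqP; rewrite -(prim_order_dvd zP) => /dvdn_leq.
by rewrite half_gt0 -addnn => /(_ isT); have := half_gt0; lia.
Qed.

Lemma legendre_prim : rho z = -1.
Proof. by rewrite /rho (negPf z0) prim_exp_half (negPf Fp_m1_neq1). Qed.

Lemma prim_exp_onto (x : F) : x != 0 -> exists i : nat, x = z ^+ i.
Proof.
move=> x0; have e : x ^+ n.*2 = 1.
  by case: (Fp_exp_half x0) => e; rewrite -muln2 exprM e ?expr1n // sqrrN expr1n.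
by have [i ->] := prim_rootP zP e; exists i.
Qed.

Lemma sum_prim_powers (V : nmodType) (f : F -> V) :
  \sum_(x | x != 0) f x = \sum_(i < n.*2) f (z ^+ i).
Proof.
rewrite -(big_mkord xpredT (fun i => f (z ^+ i))) -(big_map (fun i => z ^+ i) xpredT f).
rewrite -[LHS]big_filter; apply: perm_big; apply: uniq_perm.
- by rewrite filter_uniq // index_enum_uniq.
- rewrite map_inj_in_uniq ?iota_uniq // => i j; rewrite !mem_index_iota /= => ib jb.
  by move/eqP; rewrite (eq_prim_root_expr zP) !modn_small // => /eqP.
- move=> x; rewrite mem_filter mem_index_enum andbT; apply/idP/mapP.
    move=> x0; have [i ->] := prim_exp_onto x0; exists (i %% n.*2)%N.
      by rewrite mem_index_iota /= ltn_mod double_gt0 half_gt0.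
    by rewrite prim_expr_mod.
  by case=> i _ ->; rewrite expf_neq0.
Qed.

(** Multiplication by the non-residue [z] permutes the field and changes the sign of the sum. *)
Lemma sum_legendre : \sum_x rho x = 0.
Proof.
have e : \sum_x rho x = - \sum_x rho x.
  rewrite {1}(reindex_inj (mulfI z0)) /= -sumrN; apply: eq_bigr => x _.
  by rewrite legendreM legendre_prim mulN1r.
by apply/eqP; rewrite -eqNr -e.
Qed.

Lemma sum_nonzero_const (c : int) : \sum_(x : F | x != 0) c = c * (p%:R - 1).
Proof.
rewrite sumr_const (eq_card (B := predC1 (0 : F))) // cardC1 card_Fp // -mulr_natr.
by rewrite pE /= -[in RHS]natr1; ring.
Qed.

(** For [d != 0] write [x (x + d) = x^2 (1 + d / x)]; then [1 + d / x] runs over all elements except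
    1, so the sum is [0 - rho 1]. *)
Lemma sum_legendre_shift (d : F) :
  \sum_x rho (x * (x + d)) = p%:R * (d == 0)%:R - 1.
Proof.
rewrite (bigD1 0) //= mul0r legendre0 add0r.
have [->|d0] := eqVneq d 0.
  rewrite mulr1 -[_ - 1]mul1r -sum_nonzero_const; apply: eq_bigr => x x0.
  by rewrite addr0 -expr2 legendre_sqr x0.
rewrite mulr0 add0r.
have dI : injective (fun x : F => d / x).
  by move=> x y /(mulfI d0) /invr_inj.
transitivity (\sum_(x : F | x != 0) rho (1 + d / x)).
  apply: eq_bigr => x x0; have -> : x * (x + d) = x ^+ 2 * (1 + d / x).
    by field.
  by rewrite legendreM legendre_sqr x0 mul1r.
transitivity (\sum_(x : F | x != 0) rho (1 + x)).
  rewrite [RHS](reindex_inj dI) /=; apply: eq_bigl => x.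
  by rewrite mulf_eq0 invr_eq0 (negPf d0).
have := sum_legendre; rewrite (reindex_inj (addrI 1)) (bigD1 0) //= addr0.
have -> : rho 1 = 1 by rewrite /rho oner_eq0 expr1n eqxx.
by move=> e; apply/eqP; rewrite -addr_eq0 addrC e.
Qed.

Definition jacobsthal (a : F) : int := \sum_t rho t * rho (t ^+ 2 - a).

Lemma jacobsthal0 : jacobsthal 0 = 0.
Proof.
rewrite -sum_legendre; apply: eq_bigr => t _; rewrite subr0 legendre_sqr.
by have [->|] := eqVneq t 0; rewrite ?legendre0 ?mulr1 ?mulr0.
Qed.

Lemma jacobsthalM (a b : F) : b != 0 -> jacobsthal (a * b ^+ 2) = rho b * jacobsthal a.
Proof.
move=> b0; rewrite /jacobsthal (reindex_inj (mulfI b0)) mulr_sumr.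
apply: eq_bigr => t _ /=; have -> : (b * t) ^+ 2 - a * b ^+ 2 = b ^+ 2 * (t ^+ 2 - a) by ring.
by rewrite (legendreM b t) (legendreM (b ^+ 2)) legendre_sqr b0 /=; ring.
Qed.

Hypothesis n_even : ~~ odd n.

Lemma legendreN (x : F) : rho (- x) = rho x.
Proof.
rewrite -mulN1r legendreM; have -> : rho (-1) = 1.
  by rewrite /rho oppr_eq0 oner_eq0 -signr_odd (negPf n_even) eqxx.
by rewrite mul1r.
Qed.

(** After expanding the square, the sum over [a] is a shifted sum with [d = t^2 - s^2]. Its constant
    part [-1] contributes a multiple of [sum_legendre], and its part in [p] leaves [t = s] and
    [t = -s] for each nonzero [s]. *)
Lemma sum_jacobsthal_sqr :
  \sum_a jacobsthal a ^+ 2 = 2%:R * p%:R * (p%:R - 1).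
Proof.
transitivity (\sum_s \sum_t rho s * rho t * (p%:R * (t ^+ 2 - s ^+ 2 == 0)%:R - 1)).
  transitivity (\sum_a \sum_s \sum_t rho s * rho t * (rho (s ^+ 2 - a) * rho (t ^+ 2 - a))).
    apply: eq_bigr => a _; rewrite expr2 mulr_suml; apply: eq_bigr => s _.
    by rewrite mulr_sumr; apply: eq_bigr => t _; ring.
  rewrite exchange_big; apply: eq_bigr => s _ /=.
  rewrite exchange_big; apply: eq_bigr => t _ /=.
  rewrite -mulr_sumr; congr (_ * _); rewrite -sum_legendre_shift.
  (* The substitution [a -> s^2 - a] turns [s^2 - a] into [a] and [t^2 - a] into
     [a + (t^2 - s^2)]. *)
  rewrite (reindex_inj (inv_inj (subKr (s ^+ 2)))) /=.
  by apply: eq_bigr => a _; rewrite -legendreM; congr (rho (_ * _)); ring.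
transitivity (\sum_s (p%:R * \sum_(t | t ^+ 2 - s ^+ 2 == 0) rho s * rho t
    - rho s * \sum_t rho t)).
  apply: eq_bigr => s _; rewrite [X in p%:R * X]big_mkcond !mulr_sumr -sumrB.
  by apply: eq_bigr => t _; case: ifP => _ /=; ring.
rewrite sum_legendre; transitivity (\sum_(s : F | s != (0 : F)) (2%:R * p%:R : int)).
  rewrite [RHS]big_mkcond; apply: eq_bigr => s _; rewrite mulr0 subr0.
  have [->|s0] /= := eqVneq s 0.
    by rewrite big1 ?mulr0 // => t _; rewrite legendre0 mul0r.
  rewrite mulrC; congr (_ * _).
  have sNs : s != - s.
    apply: contraNneq Fp_m1_neq1 => e; apply/eqP; apply: (mulIf s0).
    by rewrite mulN1r mul1r -e.
  rewrite (bigD1 s) ?subrr //= (bigD1 (- s)) /=; last by rewrite sqrrN subrr eqxx eq_sym sNs.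
  rewrite big1 => [|t]; last first.
    by rewrite subr_sqr mulf_eq0 subr_eq0 addr_eq0 => /andP[/andP[/orP[] -> //]].
  rewrite legendreN addr0 -legendreM -expr2 legendre_sqr s0 /=; ring.
by rewrite sum_nonzero_const.
Qed.

(** By [jacobsthalM], [jacobsthal a ^+ 2] depends only on the quadratic character of [a], so the sum
    of all squares is [(p - 1) / 2] times the left side. *)
Lemma jacobsthal_two_squares :
  jacobsthal 1 ^+ 2 + jacobsthal z ^+ 2 = 4%:R * p%:R.
Proof.
have J a : a != 0 -> 2%:R * jacobsthal a ^+ 2
    = jacobsthal 1 ^+ 2 * (1 + rho a) + jacobsthal z ^+ 2 * (1 - rho a).
  move=> a0; have [i ->] := prim_exp_onto a0.
  have zi : z ^+ i./2 != 0 by rewrite expf_neq0.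
  have sq : rho (z ^+ i./2) ^+ 2 = 1.
    by rewrite expr2 -legendreM -expr2 legendre_sqr zi.
  rewrite -(odd_double_half i) exprD -muln2 exprM.
  rewrite jacobsthalM // legendreM legendre_sqr zi mulr1 exprMn sq mul1r.
  case: (odd i); rewrite ?expr1 ?expr0.
    by rewrite legendre_prim; ring.
  by rewrite (_ : rho 1 = 1) ?/rho ?oner_eq0 ?expr1n ?eqxx //; ring.
have e : 2%:R * (\sum_a jacobsthal a ^+ 2)
    = (p%:R - 1) * (jacobsthal 1 ^+ 2 + jacobsthal z ^+ 2).
  rewrite (bigD1 0) //= jacobsthal0 expr0n add0r mulr_sumr (eq_bigr _ J).
  rewrite big_split -!mulr_sumr big_split sumrB /=.
  have s0 : \sum_(a | a != 0) rho a = 0.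
    by have := sum_legendre; rewrite (bigD1 0) //= legendre0 add0r.
  by rewrite s0 sum_nonzero_const; ring.
have p1 : p%:R - 1 != 0 :> int.
  by rewrite subr_eq0 -[1]/(1%:R) eqr_nat pE eqSS double_eq0 -lt0n half_gt0.
by apply: (mulfI p1); rewrite -e sum_jacobsthal_sqr; ring.
Qed.

(** Since [-1] is a square, [t] and [-t] contribute equally and the powers [z^i] with [i < n] give
    half the sum. There [t = 1] contributes 0 and each of the other [n - 1] terms is 1 or -1, with
    [n - 1] odd. *)
Lemma jacobsthal_half : exists A : int, jacobsthal 1 = 2%:R * (2%:R * A + 1).
Proof.
pose h t := rho t * rho (t ^+ 2 - 1).
have n0 := half_gt0.
have hN t : h (- t) = h t by rewrite /h legendreN sqrrN.
have -> : jacobsthal 1 = 2%:R * \sum_(i < n) h (z ^+ i).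
  rewrite /jacobsthal (bigD1 0) //= legendre0 mul0r add0r.
  rewrite (sum_prim_powers h) -addnn big_split_ord /= mulr_natl mulr2n.
  congr (_ + _); apply: eq_bigr => i _.
  by rewrite exprD prim_exp_half mulN1r hN.
have h_odd i : (0 < i < n)%N -> exists e : int, h (z ^+ i) = 2%:R * e + 1.
  move=> /andP[i0 iN]; have zi : z ^+ i != 0 by rewrite expf_neq0.
  have z2 : (z ^+ i) ^+ 2 - 1 != 0.
    rewrite subr_eq0 -exprM -(prim_order_dvd zP) gtnNdvd ?muln_gt0 ?i0 //.
    by rewrite muln2 ltn_double.
  rewrite /h; case: (legendre_cases zi) => ->; case: (legendre_cases z2) => ->;
    by [exists 0|exists (-1)].
have sum_odd k : (k < n)%N -> exists e : int,
    \sum_(i < k.+1) h (z ^+ i) = 2%:R * e + k%:R.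
  elim: k => [|k IH] kn.
    exists 0; rewrite big_ord_recl big_ord0 expr0 /h expr1n subrr legendre0; ring.
  have [e he] := IH (ltnW kn); have [e' he'] := h_odd k.+1 kn.
  by exists (e + e'); rewrite big_ord_recr /= he he'; ring.
have kn : (n.-1 < n)%N by rewrite prednK.
have [e] := sum_odd _ kn; rewrite prednK // => ->.
exists (e + (n./2)%:R - 1).
have nE : n = n./2.*2 by rewrite -[LHS]odd_double_half (negPf n_even).
have -> : n.-1%:R = 2%:R * (n./2)%:R - 1 :> int.
  by rewrite -subn1 natrB // {1}nE -muln2 natrM; ring.
by ring.
Qed.

End PrimitiveRoot.
End Jacobsthal.

(** * Congruences modulo p^2 *)

Section ModSquare.
Variables (R : comUnitRingType) (p n : nat).
Hypothesis p_pr : prime p.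
Hypothesis pE : p = n.*2.+1.
(* The next two hypotheses say that [R] is Z/p^2. *)
Hypothesis natR_eq0 : forall k : nat, (k%:R == 0 :> R) = (p ^ 2 %| k)%N.
Hypothesis natR_surj : forall x : R, exists k : nat, x = k%:R.
Local Notation P := (p%:R : R).

Lemma charP2 : P * P = 0.
Proof. by apply/eqP; rewrite -natrM natR_eq0 mulnn. Qed.

Lemma natR_unit (k : nat) : coprime p k -> (k%:R : R) \is a GRing.unit.
Proof.
move=> cpk; have k0 : (0 < k)%N.
  case: k cpk => // /eqP; rewrite gcdn0 => p1.
  by have := p_pr; rewrite p1.
have cp2 : coprime k (p ^ 2) by rewrite coprime_sym coprimeXl.
case: (egcdnP (p ^ 2) k0) => u v e _.
move: e; rewrite (eqP cp2) => /(congr1 (fun i => i%:R : R)).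
have p20 : (p ^ 2)%:R = 0 :> R by apply/eqP; rewrite natR_eq0.
rewrite natrD [(v * _)%:R]natrM p20 mulr0 add0r natrM => e.
by apply/unitrP; exists u%:R; split=> //; rewrite mulrC.
Qed.

Lemma intR_unit (b : int) : coprime p `|b| -> (b%:~R : R) \is a GRing.unit.
Proof.
move=> /natR_unit; case: b => k //=.
by rewrite NegzE rmorphN unitrN.
Qed.

Lemma intR_eq0 (a : int) : (a%:~R == 0 :> R) = ((p ^ 2)%:Z %| a)%Z.
Proof.
case: a => k; first by rewrite /intmul natR_eq0.
by rewrite NegzE rmorphN oppr_eq0 natR_eq0.
Qed.

(** The annihilator of [p] in Z/p^2 is the ideal generated by [p]; hence [P * x = 0] serves from
    here on to express that [x] is 0 modulo [p]. *)
Lemma ann_char (x : R) : P * x = 0 -> exists y, x = P * y.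
Proof.
have [k ->] := natR_surj x; move/eqP; rewrite -natrM natR_eq0 expnS expn1.
rewrite dvdn_pmul2l ?prime_gt0 // => /dvdnP[d ->].
by exists d%:R; rewrite natrM mulrC.
Qed.

Lemma mul_ann_char (x y : R) : P * x = 0 -> P * y = 0 -> x * y = 0.
Proof. by case/ann_char => z -> Py; rewrite mulrAC Py mul0r. Qed.

(** The inverse of [y + p z] is the geometric series of [p z / y], which stops after two terms
    because [p^2 = 0]. *)
Lemma unit_ann_char (x y : R) :
  P * (x - y) = 0 -> y \is a GRing.unit -> x \is a GRing.unit.
Proof.
case/ann_char => z e yU; have -> : x = y + P * z by rewrite -e addrC subrK.
apply/unitrP; exists (y^-1 * (1 - P * z * y^-1)).
have yy : y * y^-1 = 1 by rewrite divrr.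
have key : (y + P * z) * (y^-1 * (1 - P * z * y^-1)) = 1.
  have := charP2; set v := y^-1 in yy *; set Q := P => QQ.
  transitivity ((y * v) * (1 - Q * z * v) + Q * z * v - (Q * Q) * z ^+ 2 * v ^+ 2).
    by ring.
  by rewrite yy QQ; ring.
by split=> //; rewrite mulrC.
Qed.

(** * Reduction of rationals with denominator prime to [p] *)

(** The fraction need not be in lowest terms, which makes closure under the ring operations
    immediate; [denq_divz] later recovers the reduced denominator. *)
Definition reduces (q : rat) (r : R) : Prop :=
  exists a b : int, [/\ coprime p `|b|, q = a%:~R / b%:~R & r * b%:~R = a%:~R].

Lemma coprime_int_neq0 (b : int) : coprime p `|b| -> b != 0.
Proof.
apply: contraTneq => ->; rewrite /coprime gcdn0.
by apply: contraTneq p_pr => ->.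
Qed.

Lemma reduces_int (a : int) : reduces a%:~R a%:~R.
Proof. by exists a, 1; rewrite coprimen1 divr1 mulr1. Qed.

Lemma reduces_nat (k : nat) : reduces k%:R k%:R.
Proof. exact: (reduces_int k%:Z). Qed.

Lemma reducesD (q1 q2 : rat) (r1 r2 : R) :
  reduces q1 r1 -> reduces q2 r2 -> reduces (q1 + q2) (r1 + r2).
Proof.
move=> [a [b [cb -> e]]] [c [d [cd -> f]]].
exists (a * d + c * b), (b * d); split.
- by rewrite abszM coprimeMr cb cd.
- have b0 := coprime_int_neq0 cb; have d0 := coprime_int_neq0 cd.
  by rewrite addf_div ?intr_eq0 // !(rmorphD, rmorphM).
- by rewrite intrD !intrM -e -f; ring.
Qed.

Lemma reducesM (q1 q2 : rat) (r1 r2 : R) :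
  reduces q1 r1 -> reduces q2 r2 -> reduces (q1 * q2) (r1 * r2).
Proof.
move=> [a [b [cb -> e]]] [c [d [cd -> f]]].
exists (a * c), (b * d); split.
- by rewrite abszM coprimeMr cb cd.
- by rewrite mulf_div !rmorphM.
- by rewrite !intrM -e -f; ring.
Qed.

Lemma reducesX (q : rat) (r : R) (k : nat) :
  reduces q r -> reduces (q ^+ k) (r ^+ k).
Proof.
move=> qr; elim: k => [|k IH]; first exact: (reduces_nat 1).
by rewrite !exprS; apply: reducesM.
Qed.

Lemma reducesN (q : rat) (r : R) : reduces q r -> reduces (- q) (- r).
Proof.
by move=> qr; rewrite -mulN1r -[- r]mulN1r; apply: reducesM (reduces_int (-1)) _.
Qed.

Lemma reduces_sum (N : nat) (F : nat -> rat) (G : nat -> R) :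
  (forall k, (k < N)%N -> reduces (F k) (G k)) ->
  reduces (\sum_(k < N) F k) (\sum_(k < N) G k).
Proof.
elim: N => [|N IH] H; first by rewrite !big_ord0; apply: (reduces_nat 0).
rewrite !big_ord_recr; apply: reducesD; last exact: H.
by apply: IH => k kN; apply: H; apply: ltnW.
Qed.

Lemma reducesV (b : int) : coprime p `|b| -> reduces (b%:~R)^-1 (b%:~R)^-1.
Proof.
by move=> cb; exists 1, b; rewrite mul1r mulVr ?intR_unit.
Qed.

Lemma reduces_inj (q : rat) (r1 r2 : R) :
  reduces q r1 -> reduces q r2 -> r1 = r2.
Proof.
move=> [a [b [cb -> e]]] [c [d [cd f g]]].
have b0 := coprime_int_neq0 cb; have d0 := coprime_int_neq0 cd.
have h : a * d = c * b.
  apply/eqP; rewrite -(eqr_int rat) !intrM; apply/eqP.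
  by move/eqP: f; rewrite eqr_div ?intr_eq0 // => /eqP.
apply: (mulIr (intR_unit cb)); apply: (mulIr (intR_unit cd)).
by rewrite e -intrM h intrM -g mulrAC.
Qed.

Lemma denq_divz (e f : int) : f != 0 -> (denq (e%:~R / f%:~R) %| f)%Z.
Proof.
move=> f0; set x := e%:~R / f%:~R.
have h : numq x * f = e * denq x.
  apply/eqP; rewrite -(eqr_int rat) !intrM; apply/eqP.
  by rewrite numqE /x mulrAC divfK ?intr_eq0.
have : (denq x %| numq x * f)%Z by rewrite h dvdz_mull.
by rewrite Gauss_dvdzr // coprimez_sym; apply: coprime_num_den.
Qed.

Lemma reduces_congr (q1 q2 : rat) (r : R) :
  reduces q1 r -> reduces q2 r -> rat_congr p 2 q1 q2.
Proof.
move=> [a [b [cb -> e]]] [c [d [cd -> f]]].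
have b0 := coprime_int_neq0 cb; have d0 := coprime_int_neq0 cd.
have : (a * d - c * b)%:~R == 0 :> R.
  by rewrite intrB !intrM -e -f subr_eq0; apply/eqP; ring.
rewrite intR_eq0 => /dvdzP[g h].
exists (g%:~R / (b * d)%:~R); split.
  have bd0 : b * d != 0 by rewrite mulf_neq0.
  apply: coprime_dvdr (_ : coprime p `|b * d|); first exact: denq_divz.
  by rewrite abszM coprimeMr cb cd.
rewrite -mulNr addf_div ?intr_eq0 // mulrA intrM; congr (_ / _).
transitivity ((a * d - c * b)%:~R : rat); first by rewrite intrB !intrM mulNr.
by rewrite h intrM mulrC.
Qed.

Lemma small_unit (k : nat) : (0 < k < p)%N -> (k%:R : R) \is a GRing.unit.
Proof.
case/andP=> k0 kp; apply: natR_unit.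
by rewrite prime_coprime // gtnNdvd.
Qed.

Lemma natR2_unit : (2%:R : R) \is a GRing.unit.
Proof.
apply: natR_unit; rewrite prime_coprime // -prime_coprime //.
by rewrite coprimen2 pE /= odd_double.
Qed.

(** * Binomial coefficients of [-1/2] modulo [p^2] *)

Lemma natR_p : P = 2%:R * n%:R + 1.
Proof. by rewrite pE -natr1 -muln2 natrM mulrC. Qed.

(* [(p ^ 2 - 1) / 2], a natural number equal to [-1/2] in [R], so that
   [mhalf_bin k] below is the binomial coefficient of [-1/2] over [k]. *)
Definition halfsq : nat := (p ^ 2).-1./2.

Lemma halfsqE : (p ^ 2 = halfsq.*2.+1)%N.
Proof.
have := odd_double_half (p ^ 2).-1.
have -> : odd (p ^ 2).-1 = false.
  by rewrite -subn1 oddB ?expn_gt0 ?prime_gt0 // oddX pE /= odd_double.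
by rewrite add0n /halfsq => ->; rewrite prednK // expn_gt0 prime_gt0.
Qed.

Local Notation mhalf := (halfsq%:R : R).

Lemma halfsqR : 2%:R * mhalf = -1.
Proof.
have := charP2; rewrite -natrM mulnn halfsqE -natr1 -muln2 natrM => e.
by apply/eqP; rewrite -subr_eq0 opprK mulrC e.
Qed.

Definition mhalf_bin (k : nat) : R := 'C(halfsq, k)%:R.

Lemma mhalf_binS (k : nat) : 2%:R * k.+1%:R * mhalf_bin k.+1 = - (2%:R * k%:R + 1) * mhalf_bin k.
Proof.
rewrite -mulrA natr_binS /mhalf_bin; have := halfsqR; set B := mhalf => e.
by ring: e.
Qed.

Lemma mhalf_bin0 : mhalf_bin 0 = 1. Proof. by rewrite /mhalf_bin bin0. Qed.

(** The classical [binom(2k, k) = (-4)^k binom(-1/2, k)], by the common recurrence; [k <= n] keeps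
    the divisors invertible. *)
Lemma mhalf_bin_central (k : nat) :
  (k <= n)%N -> mhalf_bin k * (- 4%:R) ^+ k = 'C(2 * k, k)%:R.
Proof.
elim: k => [|k IH] kn; first by rewrite mhalf_bin0 mulr1 bin0.
have kU : k.+1%:R \is a @GRing.unit R by apply: small_unit; rewrite pE; lia.
apply: (mulrI kU).
have -> : k.+1%:R * 'C(2 * k.+1, k.+1)%:R
    = (2 * (2 * k + 1))%:R * 'C(2 * k, k)%:R :> R by rewrite -!natrM double_binS.
rewrite -IH 1?ltnW // exprS.
have := mhalf_binS k => e.
transitivity (- 2%:R * (2%:R * k.+1%:R * mhalf_bin k.+1) * (- 4%:R) ^+ k); first by ring.
by rewrite e; ring.
Qed.

Lemma natR_N : 4%:R * (n * n.+1)%:R = -1 :> R.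
Proof.
transitivity (P * P - 1); last by rewrite charP2 sub0r.
by rewrite natR_p; ring.
Qed.

(** The recurrences agree because [4 n (n+1) = p^2 - 1] gives [4 (n (n+1) - k (k+1)) = - (2k+1)^2]
    in Z/p^2. *)
Lemma leg_coef_mhalf_bin (k : nat) : (k <= n)%N -> (leg_coef n k)%:R = (-1) ^+ k * mhalf_bin k ^+ 2.
Proof.
elim: k => [|k IH] kn; first by rewrite mhalf_bin0 leg_coef0 expr1n mulr1.
have kU : (2%:R * k.+1%:R) ^+ 2 \is a @GRing.unit R.
  by rewrite unitrX // unitrM natR2_unit small_unit // pE; lia.
apply: (mulrI kU); have h1 := leg_coefS_ring R n k; have h2 := mhalf_binS k.
transitivity (4%:R * (k.+1%:R ^+ 2 * (leg_coef n k.+1)%:R) : R); first by ring.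
rewrite h1 IH 1?ltnW //.
transitivity (- (-1) ^+ k * (2%:R * k.+1%:R * mhalf_bin k.+1) ^+ 2).
  2: by rewrite [(-1) ^+ k.+1]exprS; set s := (-1) ^+ k; ring.
rewrite h2; have := natR_N; set M := (n * n.+1)%:R => hM.
transitivity ((4%:R * M - 4%:R * (k * k.+1)%:R) * ((-1) ^+ k * mhalf_bin k ^+ 2)); first by ring.
by rewrite hM; ring.
Qed.

(** [n] is [-1/2] modulo [p]. *)
Lemma mhalf_bin_bin (k : nat) : (k <= n)%N -> P * (mhalf_bin k - 'C(n, k)%:R) = 0.
Proof.
elim: k => [|k IH] kn; first by rewrite mhalf_bin0 bin0 subrr mulr0.
have kU : 2%:R * k.+1%:R \is a @GRing.unit R.
  by rewrite unitrM natR2_unit small_unit // pE; lia.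
apply: (mulrI kU); have h1 := mhalf_binS k; have h2 := natr_binS R n k.
rewrite mulr0.
transitivity (P * (2%:R * k.+1%:R * mhalf_bin k.+1 - 2%:R * (k.+1%:R * 'C(n, k.+1)%:R))).
  by ring.
rewrite h1 h2.
transitivity (- (2%:R * k%:R + 1) * (P * (mhalf_bin k - 'C(n, k)%:R))
  - P * (2%:R * n%:R + 1) * 'C(n, k)%:R); first by ring.
by rewrite IH 1?ltnW // -natR_p charP2; ring.
Qed.

Lemma mhalf_bin_sym (k : nat) : (k <= n)%N -> P * (mhalf_bin k - mhalf_bin (n - k)) = 0.
Proof.
move=> kn; have h1 := mhalf_bin_bin kn; have := mhalf_bin_bin (leq_subr k n).
rewrite bin_sub // => h2.
transitivity (P * (mhalf_bin k - 'C(n, k)%:R) - P * (mhalf_bin (n - k) - 'C(n, k)%:R)); first by ring.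
by rewrite h1 h2 subrr.
Qed.

(** The difference of the two coefficients is a multiple of [p], so its square is 0. *)
Lemma mhalf_bin_sym_sqr (k : nat) : (k <= n)%N ->
  mhalf_bin k ^+ 2 + mhalf_bin (n - k) ^+ 2 = 2%:R * (mhalf_bin k * mhalf_bin (n - k)).
Proof.
move=> kn; have e := mul_ann_char (mhalf_bin_sym kn) (mhalf_bin_sym kn).
by apply/eqP; rewrite -subr_eq0 -e; apply/eqP; ring.
Qed.

(** * The values of the Legendre polynomial and of its derivative at 1 *)

Definition Tsum : R := \sum_(k < n.+1) (-1) ^+ k * mhalf_bin k ^+ 2.
Definition Usum : R := \sum_(k < n.+1) k%:R * (-1) ^+ k * mhalf_bin k ^+ 2.

(** Adding the sum to its reversal and applying [mhalf_bin_sym_sqr] turns the squares into products,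
    which [alternating_conv] evaluates. *)
Lemma Tsum_even (m : nat) : n = m.*2 -> Tsum = (-1) ^+ m * mhalf_bin m.
Proof.
move=> nm; have sn : (-1) ^+ n = 1 :> R by rewrite -signr_odd nm odd_double.
apply: (mulrI natR2_unit).
have -> : 2%:R * Tsum = Tsum + \sum_(k < n.+1) (-1) ^+ (n - k) * mhalf_bin (n - k) ^+ 2.
  by rewrite -(sum_ord_rev _ (fun k => (-1) ^+ k * mhalf_bin k ^+ 2)) /Tsum; ring.
rewrite -big_split /=.
have := alternating_conv R halfsq n; rewrite nm odd_double doubleK -nm /mhalf_bin => <-.
rewrite mulr_sumr; apply: eq_bigr => k _.
have kn : (k <= n)%N by rewrite -ltnS.
rewrite signr_subn // sn mul1r.
have := mhalf_bin_sym_sqr kn; rewrite /mhalf_bin => e.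
by rewrite -mulrDr e; ring.
Qed.

(** For odd [n] the terms [k] and [n - k] have opposite signs and cancel modulo [p]. *)
Lemma Tsum_odd : odd n -> P * Tsum = 0.
Proof.
move=> no; have sn : (-1) ^+ n = -1 :> R by rewrite -signr_odd no.
apply: (mulrI natR2_unit); rewrite mulr0.
transitivity (P * (Tsum + \sum_(k < n.+1) (-1) ^+ (n - k) * mhalf_bin (n - k) ^+ 2)).
  by rewrite -(sum_ord_rev _ (fun k => (-1) ^+ k * mhalf_bin k ^+ 2)) /Tsum; ring.
rewrite -big_split mulr_sumr big1 // => k _ /=.
have kn : (k <= n)%N by rewrite -ltnS.
rewrite signr_subn // sn.
have e := mhalf_bin_sym kn.
transitivity ((-1) ^+ k * (mhalf_bin k + mhalf_bin (n - k)) * (P * (mhalf_bin k - mhalf_bin (n - k)))).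
  by ring.
by rewrite e mulr0.
Qed.

(** Pairing [k] with [n - k] leaves [k (a_k^2 + a_(n-k)^2) - n a_(n-k)^2] up to sign: the first part
    becomes the weighted convolution, the second is the multiple of [Tsum]. *)
Lemma Usum_odd (m : nat) : n = m.*2.+1 ->
  2%:R * Usum = (-1) ^+ m * 'C(halfsq.-1, m)%:R + n%:R * Tsum.
Proof.
move=> nm; have sn : (-1) ^+ n = -1 :> R by rewrite -signr_odd nm /= odd_double.
have b0 : (0 < halfsq)%N.
  by have := halfsqE; have := prime_gt1 p_pr; case: halfsq => // p1; rewrite /= -mulnn; nia.
have := alternating_conv_weighted R halfsq.-1 m; rewrite prednK // -nm => conv.
have b2 : 2%:R * mhalf = -1 := halfsqR.
have -> : (-1) ^+ m * 'C(halfsq.-1, m)%:R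
    = 2%:R * (- mhalf * (-1) ^+ m * 'C(halfsq.-1, m)%:R).
  transitivity (- (2%:R * mhalf) * ((-1) ^+ m * 'C(halfsq.-1, m)%:R)); last by ring.
  by rewrite b2; ring.
rewrite -conv.
have -> : n%:R * Tsum = n%:R * \sum_(k < n.+1) (-1) ^+ (n - k) * mhalf_bin (n - k) ^+ 2.
  by rewrite -(sum_ord_rev _ (fun k => (-1) ^+ k * mhalf_bin k ^+ 2)).
have -> : 2%:R * Usum
    = Usum + \sum_(k < n.+1) (n - k)%:R * (-1) ^+ (n - k) * mhalf_bin (n - k) ^+ 2.
  by rewrite -(sum_ord_rev _ (fun k => k%:R * (-1) ^+ k * mhalf_bin k ^+ 2)) /Usum; ring.
rewrite !mulr_sumr -!big_split; apply: eq_bigr => k _ /=.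
have kn : (k <= n)%N by rewrite -ltnS.
rewrite signr_subn // sn.
have := mhalf_bin_sym_sqr kn; rewrite natrB // /mhalf_bin => e.
transitivity (k%:R * (-1) ^+ k * (2%:R * ('C(halfsq, k)%:R * 'C(halfsq, n - k)%:R))
   - n%:R * (-1) ^+ k * 'C(halfsq, n - k)%:R ^+ 2 : R); last by ring.
by rewrite -e; ring.
Qed.

(** * A Wronskian and the Legendre-type relation *)

Section Wronskian.

(** In Z/p^2 this is the Legendre polynomial with [x] replaced by [-x], so evaluations below are at
    [-1]; [g] is its reciprocal polynomial. *)
Let f : {poly R} := \poly_(k < n.+1) mhalf_bin k ^+ 2.
Let g : {poly R} := \poly_(k < n.+1) mhalf_bin (n - k) ^+ 2.
Local Notation PP := (p%:R : {poly R}).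

Let PP2 : PP * PP = 0.
Proof. by rewrite -!polyC_natr -polyCM charP2. Qed.

Let mhalf_binS2 k : 4%:R * k.+1%:R ^+ 2 * mhalf_bin k.+1 ^+ 2
  = (2%:R * k%:R + 1) ^+ 2 * mhalf_bin k ^+ 2.
Proof.
transitivity ((2%:R * k.+1%:R * mhalf_bin k.+1) ^+ 2); first by ring.
by rewrite mhalf_binS; ring.
Qed.

Let ode_f :
  4%:R * theta (theta f) = 'X * (4%:R * theta (theta f) + 4%:R * theta f + f).
Proof.
apply/polyP => -[|k]; rewrite coefXM /=.
  by rewrite mulr_natl coefMn !coef_theta !mul0r mul0rn.
rewrite !mulr_natl !(coefMn, coefD) !coef_theta !coef_poly !ltnS.
case: (ltngtP k n) => kn.
- transitivity (4%:R * k.+1%:R ^+ 2 * mhalf_bin k.+1 ^+ 2); first by ring.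
  by rewrite mhalf_binS2; ring.
- by ring.
(* In degree [n + 1] the right side has the factor [(2n+1)^2 = p^2 = 0], so the truncated series
   still solves the equation. *)
- rewrite kn; transitivity ((2%:R * n%:R + 1) * (2%:R * n%:R + 1) * mhalf_bin n ^+ 2).
    by rewrite -natR_p charP2; ring.
  by ring.
Qed.

(** The recurrence of [f] read backwards: for [j = n - k - 1], [2j + 1] is [p - 2 (k+1)] and
    [2j + 2] is [p - (2k+1)], whence the terms in [PP]. *)
Let ode_g :
  4%:R * theta (theta g) = 4%:R * PP * theta g
    + 'X * (4%:R * theta (theta g) + 4%:R * theta g + g
            - PP * (4%:R * theta g + 2%:R * g)).
Proof.
apply/polyP => k.
rewrite -mulrA !mulr_natl [RHS]coefD !coefMn [X in _ + X]coefXM /=.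
case: k => [|k] /=; first by rewrite !coef_theta !mul0r !mul0rn addr0.
rewrite !(coefMn, coefB, coefD) !coef_theta !coef_poly !ltnS.
case: (ltngtP k n) => kn.
- set j := (n - k.+1)%N.
  have kj : (n - k)%N = j.+1 by rewrite /j subnSK.
  have nE : n%:R = k%:R + j%:R + 1 :> R.
    by rewrite -natrD natr1; congr (_%:R); rewrite /j; lia.
  have e := mhalf_binS2 j; have P2 := charP2; have := natR_p; rewrite nE => Pe; rewrite kj.
  apply/eqP; rewrite -subr_eq0; apply/eqP.
  transitivity (- P * P * (mhalf_bin j ^+ 2 - mhalf_bin j.+1 ^+ 2)
     + (2%:R * k.+1%:R - P) ^+ 2 * mhalf_bin j ^+ 2
     - (2%:R * k%:R + 1 - P) ^+ 2 * mhalf_bin j.+1 ^+ 2); first by ring.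
  have -> : 2%:R * k.+1%:R - P = - (2%:R * j%:R + 1) by rewrite Pe; ring.
  have -> : 2%:R * k%:R + 1 - P = - (2%:R * j.+1%:R) by rewrite Pe; ring.
  transitivity ((2%:R * j%:R + 1) ^+ 2 * mhalf_bin j ^+ 2 - 4%:R * j.+1%:R ^+ 2 * mhalf_bin j.+1 ^+ 2
     - P * P * (mhalf_bin j ^+ 2 - mhalf_bin j.+1 ^+ 2)); first by ring.
  by rewrite e P2; ring.
- by ring.
- rewrite kn; set A := mhalf_bin _ ^+ 2.
  transitivity ((P * P - (2%:R * n%:R + 1 - P) ^+ 2) * - A).
    by rewrite charP2 natR_p; ring.
  by ring.
Qed.

(* A Wronskian: since [f] and [g] solve the same equation up to a shift of the
   exponents by [p / 2], [2 theta w = p w], which leaves only the coefficients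
   of degrees [0] and [p]. *)
Let w := 2%:R * (1 - 'X) * (f * theta g - theta f * g) - PP * (1 - 'X) * (f * g).

Let theta_w : 2%:R * theta w = PP * w.
Proof.
have ef := ode_f; have eg := ode_g.
rewrite /w !(thetaB, thetaM) !theta_nat thetaX.
have -> : theta (1 : {poly R}) = 0 := theta_nat R 1.
move: ef eg; set F1 := theta f; set F2 := theta F1; set G1 := theta g; set G2 := theta G1.
move=> ef eg.
(* Second-order terms occur in [theta w] only multiplied by [1 - X], so each equation is solved for
   that product. *)
have {}ef : 4%:R * (1 - 'X) * F2 = 'X * (4%:R * F1 + f).
  by transitivity (4%:R * F2 - 'X * (4%:R * F2)); [ring|rewrite {1}ef; ring].
have {}eg : 4%:R * (1 - 'X) * G2 = 4%:R * PP * G1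
    + 'X * (4%:R * G1 + g - PP * (4%:R * G1 + 2%:R * g)).
  by transitivity (4%:R * G2 - 'X * (4%:R * G2)); [ring|rewrite {1}eg; ring].
transitivity (- 4%:R * 'X * (f * G1 - F1 * g)
  + f * (4%:R * (1 - 'X) * G2) - g * (4%:R * (1 - 'X) * F2)
  + 2%:R * PP * 'X * f * g - 2%:R * PP * (1 - 'X) * (F1 * g + f * G1)); first by ring.
rewrite ef eg; apply/eqP; rewrite -subr_eq0; apply/eqP.
by transitivity (PP * PP * (1 - 'X) * (f * g)); [ring|rewrite PP2; ring].
Qed.

Let size_w : (size w <= p.+1)%N.
Proof.
have sf : (size f <= n.+1)%N by apply: size_poly.
have sg : (size g <= n.+1)%N by apply: size_poly.
have stf : (size (theta f) <= n.+1)%N by rewrite theta_poly; apply: size_poly.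
have stg : (size (theta g) <= n.+1)%N by rewrite theta_poly; apply: size_poly.
have s1 : (size (1 - 'X : {poly R})%R <= 2)%N.
  by rewrite -opprB size_polyN -polyC1 size_XsubC.
have sM (u v : {poly R}) : (size u <= n.+1)%N -> (size v <= n.+1)%N ->
    (size ((1 - 'X) * (u * v) : {poly R})%R <= p.+1)%N.
  have pred2 (i j : nat) : (i <= j)%N -> (i.-1 <= j.-1)%N by lia.
  move=> su sv; apply: leq_trans (size_polyMleq _ _) _.
  apply: (@leq_trans (2 + (n.+1 + n.+1).-1).-1); last by rewrite pE -addnn; lia.
  apply: (pred2); apply: leq_add => //; apply: leq_trans (size_polyMleq _ _) _.
  by apply: pred2; exact: leq_add.
have -> : w = ((1 - 'X) * (f * theta g)) *+ 2 - ((1 - 'X) * (theta f * g)) *+ 2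
   - ((1 - 'X) * (f * g)) *+ p.
  by rewrite /w; ring.
have sMn (u : {poly R}) k : (size u <= p.+1)%N -> (size (u *+ k)%R <= p.+1)%N.
  by move=> su; apply/leq_sizeP => j jp; rewrite coefMn (leq_sizeP _ _ su) // mul0rn.
have sB (u v : {poly R}) : (size u <= p.+1)%N -> (size v <= p.+1)%N ->
    (size (u - v)%R <= p.+1)%N.
  by move=> su sv; rewrite (leq_trans (size_polyD _ _)) // size_polyN geq_max su sv.
by rewrite !sB // sMn // sM.
Qed.

(** [theta_w] gives [(2k - p) w_k = 0], and [2k - p] is a unit in this range. *)
Let w_middle k : (0 < k < p)%N -> w`_k = 0.
Proof.
move=> kp; have := congr1 (fun u : {poly R} => u`_k) theta_w.
rewrite !mulr_natl !coefMn coef_theta => e.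
have U : 2%:R * k%:R - P \is a GRing.unit.
  apply: (@unit_ann_char _ (2%:R * k%:R)).
    by transitivity (- (P * P)); [ring|rewrite charP2 oppr0].
  by rewrite unitrM natR2_unit small_unit.
apply: (mulrI U); rewrite mulr0.
by transitivity (k%:R * w`_k *+ 2 - w`_k *+ p); [ring|rewrite e subrr].
Qed.

Let w_binomial x : w.[x] = w`_0 + w`_p * x ^+ p.
Proof.
rewrite (horner_coef_wide _ size_w) big_ord_recr /=; congr (_ + _).
have := prime_gt0 p_pr; case: (p) w_middle => // p' wm _.
rewrite big_ord_recl /= expr0 mulr1 big1 ?addr0 // => i _.
by rewrite wm ?mul0r //= /bump /= add1n ltnS.
Qed.

(** [w] has only the coefficients of degrees 0 and [p]; [w(0) = -p] and [w(1) = 0] force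
    [w(-1) = -2p], while the definition of [w] expresses [w(-1)] through [Tsum] and [Usum]. *)
Lemma Tsum_Usum : Tsum * (Tsum + 4%:R * Usum) = (-1) ^+ n * P.
Proof.
have w0 : w`_0 = - P.
  rewrite /w -horner_coef0 hornerD hornerN -!polyC_natr !hornerM !hornerC hornerD hornerN hornerX hornerC.
  rewrite hornerD hornerN !hornerM !horner_coef0 !coef_theta !coef_poly /= mhalf_bin0 subn0.
  have e : P * (mhalf_bin n - 1) = 0 by have := mhalf_bin_bin (leqnn n); rewrite binn.
  transitivity (- P - P * (mhalf_bin n - 1) * (mhalf_bin n + 1)); first by ring.
  by rewrite e; ring.
have w1 : w`_0 + w`_p = 0.
  have := w_binomial 1; rewrite expr1n mulr1 => <-.
  have X1 : (1 - 'X : {poly R}).[1] = 0 by rewrite hornerD hornerN hornerX hornerC subrr.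
  by rewrite /w hornerD hornerN !hornerM X1; ring.
have sp : (-1) ^+ p = -1 :> R by rewrite -signr_odd pE /= odd_double.
have wm1 : w.[-1] = - 2%:R * P.
  rewrite w_binomial sp; have -> : w`_p = - w`_0 by apply/eqP; rewrite -addr_eq0 addrC w1.
  by rewrite w0; ring.
have hf : f.[-1] = Tsum by rewrite horner_poly; apply: eq_bigr => k _; rewrite mulrC.
have htf : (theta f).[-1] = Usum.
  by rewrite theta_poly horner_poly; apply: eq_bigr => k _; rewrite mulrAC.
have sq1 : (-1) ^+ n * (-1) ^+ n = 1 :> R by rewrite -expr2 sqrr_sign.
have hg : g.[-1] = (-1) ^+ n * Tsum.
  rewrite horner_poly (sum_ord_rev _ (fun k => mhalf_bin (n - k) ^+ 2 * (-1) ^+ k)) mulr_sumr.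
  apply: eq_bigr => k _; have kn : (k <= n)%N by rewrite -ltnS.
  by rewrite subKn // signr_subn //; ring.
have htg : (theta g).[-1] = (-1) ^+ n * (n%:R * Tsum - Usum).
  rewrite theta_poly horner_poly.
  rewrite (sum_ord_rev _ (fun k => k%:R * mhalf_bin (n - k) ^+ 2 * (-1) ^+ k)).
  rewrite mulr_sumr -sumrB mulr_sumr.
  apply: eq_bigr => k _; have kn : (k <= n)%N by rewrite -ltnS.
  by rewrite subKn // signr_subn // natrB //; ring.
move: wm1; rewrite /w hornerD hornerN -!polyC_natr !hornerM !hornerC.
rewrite !hornerD !hornerN !hornerM hornerX hornerC hf htf hg htg => wm1.
apply: (mulrI natR2_unit).
transitivity (- (-1) ^+ n * ((-1) ^+ n * (-1) ^+ n) * (- 2%:R * P)); last by rewrite sq1; ring.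
rewrite -wm1; set s := (-1) ^+ n in sq1 *.
transitivity (- (s * s) * (s * s) * ((4%:R * n%:R - 2%:R * P) * Tsum ^+ 2 - 8%:R * Tsum * Usum)).
  by rewrite sq1 natR_p; ring.
by ring.
Qed.

End Wronskian.

(** * The sum modulo [p^2] in terms of [Tsum] and [Usum] *)

Lemma coprime_le (k : nat) : (k < n.+1)%N -> coprime p k.+1.
Proof.
move=> kn; rewrite prime_coprime // gtnNdvd //.
by have := prime_gt1 p_pr; rewrite pE -addnn; lia.
Qed.

Lemma fact_unit (k : nat) : (k < p)%N -> (k`!%:R : R) \is a GRing.unit.
Proof.
elim: k => [|k IH] kp; first by rewrite unitr1.
by rewrite factS natrM unitrM IH ?small_unit // ltnW.
Qed.

Lemma bin_unit (N k : nat) : (k <= N < p)%N -> ('C(N, k)%:R : R) \is a GRing.unit.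
Proof.
case/andP=> kN Np; have := fact_unit Np.
by rewrite -(bin_fact kN) natrM unitrM => /andP[].
Qed.

Lemma Tsum_leg_coef : \sum_(k < n.+1) (leg_coef n k)%:R = Tsum.
Proof. by apply: eq_bigr => k _; rewrite leg_coef_mhalf_bin // -ltnS. Qed.

Lemma Usum_leg_coef : \sum_(k < n.+1) (k * leg_coef n k)%:R = Usum.
Proof. by apply: eq_bigr => k _; rewrite natrM leg_coef_mhalf_bin ?mulrA // -ltnS. Qed.

Lemma legendre_integral_mod :
  \sum_(k < n.+1) ((leg_coef n k)%:R * 'C(2 * k, k)%:R * 2%:R ^+ k / k.+1%:R)
  = Tsum ^+ 2 + 8%:R * Usum ^+ 2.
Proof.
have sV k : (k < n.+1)%N ->
    reduces ((leg_coef n k)%:R * 'C(2 * k, k)%:R * 2%:R ^+ k.+1 / k.+1%:R)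
            ((leg_coef n k)%:R * 'C(2 * k, k)%:R * 2%:R ^+ k.+1 / k.+1%:R).
  move=> kn; have := reducesV (b := k.+1) (coprime_le kn).
  by apply: reducesM; do ?apply: reducesM; do ?apply: reducesX; apply: reduces_nat.
have sn (F : nat -> nat) : reduces (\sum_(k < n.+1) (F k)%:R) (\sum_(k < n.+1) (F k)%:R).
  by apply: (reduces_sum (F := fun k => (F k)%:R) (G := fun k => (F k)%:R)) => k _; apply: reduces_nat.
have l := reducesM (reduces_nat (n * n.+1)) (reduces_sum sV).
rewrite legendre_integral in l.
have r : reduces (2%:R * (n * n.+1)%:R * (\sum_(k < n.+1) (leg_coef n k)%:R) ^+ 2
    - 4%:R * (\sum_(k < n.+1) (k * leg_coef n k)%:R) ^+ 2)
    (2%:R * (n * n.+1)%:R * Tsum ^+ 2 - 4%:R * Usum ^+ 2).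
  rewrite -Tsum_leg_coef -Usum_leg_coef; apply: reducesD.
    by do 2?[apply: reducesM]; rewrite ?expr2; do ?apply: reducesM; exact: reduces_nat || exact: sn.
  apply: reducesN; apply: reducesM; first exact: reduces_nat.
  by apply: reducesX; apply: (sn (fun k => k * leg_coef n k)%N).
have e := reduces_inj l r.
have e2 : \sum_(k < n.+1) ((leg_coef n k)%:R * 'C(2 * k, k)%:R * 2%:R ^+ k.+1 / k.+1%:R)
    = 2%:R * \sum_(k < n.+1) ((leg_coef n k)%:R * 'C(2 * k, k)%:R * 2%:R ^+ k / k.+1%:R) :> R.
  by rewrite mulr_sumr; apply: eq_bigr => k _; rewrite exprS; ring.
rewrite e2 in e; apply: (mulrI natR2_unit); move: e natR_N; set s := \sum_(_ < _) _.
set M := (n * n.+1)%:R => e hM.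
transitivity (- (4%:R * M) * (2%:R * s)); first by rewrite hM; ring.
transitivity (- 4%:R * (M * (2%:R * s))); first by ring.
rewrite e; transitivity (- (4%:R * M) * (2%:R * Tsum ^+ 2) + 16%:R * Usum ^+ 2); first by ring.
by rewrite hM; ring.
Qed.

(** [binom(2k,k)^2 = (-16)^k leg_coef n k], and [(-16)^k / (-8)^k = 2^k]. *)
Lemma S27_reduces : reduces (S27 p) (Tsum ^+ 2 + 8%:R * Usum ^+ 2).
Proof.
rewrite -legendre_integral_mod /S27.
have -> : p.-1./2 = n by rewrite pE /= doubleK.
apply: (reduces_sum (F := fun k => 'C(2 * k, k)%:R ^+ 3 / ((-8) ^+ k * k.+1%:R))
  (G := fun k => (leg_coef n k)%:R * 'C(2 * k, k)%:R * 2%:R ^+ k / k.+1%:R)) => k kn.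
have k1 := coprime_le kn.
pose d8 : int := (-8) ^+ k * k.+1%:Z; have k8 : coprime p `|d8|.
  rewrite abszM coprimeMr k1 andbT abszX coprimeXr //.
  by rewrite (@coprimeXr 3 p 2) // coprimen2 pE /= odd_double.
have := reducesM (reducesX 3 (reduces_nat 'C(2 * k, k))) (reducesV k8).
rewrite /d8 !intrM !rmorphXn /= => h; move: h.
set u := _ ^+ 3 / _; set v := _ ^+ 3 / _.
suff -> : v = (leg_coef n k)%:R * 'C(2 * k, k)%:R * 2%:R ^+ k / k.+1%:R by [].
have U1 := natR_unit k1; have U8 : (-8)%:~R ^+ k \is a @GRing.unit R.
  apply: unitrX; have -> : (-8)%:~R = - 2%:R ^+ 3 :> R by ring.
  by rewrite unitrN unitrX // natR2_unit.
rewrite /v invrM // mulrA mulrAC; congr (_ / _); apply: (mulIr U8); rewrite divrK //.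
rewrite leg_coef_mhalf_bin // -mhalf_bin_central //.
have -> : (-8)%:~R = 2%:R * (- 4%:R) :> R by ring.
have -> : - 4%:R = -1 * 4%:R :> R by ring.
rewrite !exprMn; have := sqrr_sign R k; set s := (-1) ^+ k.
have -> : 4%:R ^+ k = 2%:R ^+ k * 2%:R ^+ k :> R by rewrite -exprMn; congr (_ ^+ _); ring.
set t := 2%:R ^+ k; set a := mhalf_bin k => e.
transitivity (a ^+ 3 * t ^+ 6 * s * s ^+ 2); first by ring.
transitivity (a ^+ 3 * t ^+ 6 * s * s ^+ 2); last by ring.
by [].
Qed.

Lemma natR_mod (k l : nat) : k = l %[mod p] -> P * (k%:R - l%:R) = 0.
Proof.
wlog lk : k l / (l <= k)%N => [H e|].
  have [/H->//|/ltnW kl] := leqP l k.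
  by rewrite -opprB mulrN (H l k) // oppr0.
move/eqP; rewrite eqn_mod_dvd // => /dvdnP[d e].
by rewrite -natrB // e natrM mulrCA charP2 mulr0.
Qed.

Lemma pow2_fermat : P * (2%:R ^+ p.-1 - 1) = 0.
Proof.
apply: (mulrI natR2_unit); rewrite mulr0 mulrCA mulrBr -exprS prednK ?prime_gt0 //.
by rewrite mulr1 -natrX; apply: natR_mod; apply: fermat_little.
Qed.

(** [halfsq.-1] represents [-3/2]. *)
Lemma mhalf_bin_pred (m : nat) : 'C(halfsq.-1, m)%:R = (2%:R * m%:R + 1) * mhalf_bin m.
Proof.
have b2 := halfsqR; set c := 'C(_, m)%:R.
have h : halfsq%:R * c = (halfsq%:R - m%:R) * mhalf_bin m :> R.
  rewrite /c /mhalf_bin; case: (leqP m halfsq) => mb; first by rewrite -natrB // -!natrM mul_bin_down.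
  by rewrite !bin_small ?mulr0 // (leq_ltn_trans (leq_pred _)).
transitivity (- (2%:R * halfsq%:R) * c); first by rewrite b2; ring.
transitivity (- 2%:R * (halfsq%:R * c)); first by ring.
rewrite h; transitivity ((- (2%:R * halfsq%:R) + 2%:R * m%:R) * mhalf_bin m); first by ring.
by rewrite b2; ring.
Qed.

(** Here [Tsum ^+ 2 = 0], and [Usum_odd] with [Tsum_Usum] gives the value [2 c^2 + p]. It remains to
    express [c^2] through [binom(n, m)] and [2^(p-1)]. *)
Lemma odd_value (m : nat) : n = m.*2.+1 ->
  4%:R * (Tsum ^+ 2 + 8%:R * Usum ^+ 2)
  = 2%:R * (2%:R * P + 2%:R - 2%:R ^+ p.-1) * 'C(n, m)%:R ^+ 2 + 4%:R * P.
Proof.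
move=> nm; have PT : P * Tsum = 0 by apply: Tsum_odd; rewrite nm /= odd_double.
have TT := mul_ann_char PT PT.
have sn : (-1) ^+ n = -1 :> R by rewrite -signr_odd nm /= odd_double.
have sm : (-1) ^+ m * (-1) ^+ m = 1 :> R by rewrite -expr2 sqrr_sign.
have := Tsum_Usum; rewrite sn; have := Usum_odd nm.
set c := 'C(halfsq.-1, m)%:R; set s := (-1) ^+ m in sm * => e L.
have PE := natR_p.
have TW : 2%:R * Tsum * (s * c) = - P.
  have -> : s * c = 2%:R * Usum - n%:R * Tsum by rewrite e; ring.
  transitivity (Tsum * (Tsum + 4%:R * Usum) - (1 + 2%:R * n%:R) * (Tsum * Tsum)); first by ring.
  by rewrite L TT; ring.
have val : Tsum ^+ 2 + 8%:R * Usum ^+ 2 = 2%:R * c ^+ 2 + P.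
  transitivity (Tsum * Tsum + 2%:R * (2%:R * Usum) ^+ 2); first by ring.
  rewrite e; transitivity ((1 + 2%:R * n%:R ^+ 2) * (Tsum * Tsum) + 2%:R * (s * s) * c ^+ 2
    + 2%:R * n%:R * (2%:R * Tsum * (s * c))); first by ring.
  rewrite TW TT sm; transitivity (2%:R * c ^+ 2 + P - P * (2%:R * n%:R + 1)); first by ring.
  by rewrite -PE charP2; ring.
have hc : c = (2%:R * m%:R + 1) * mhalf_bin m := mhalf_bin_pred m.
have mn : (m <= n)%N by rewrite nm -addnn; lia.
have c4 : c * (- 4%:R) ^+ m = m.+1%:R * 'C(n, m)%:R.
  rewrite hc -mulrA mhalf_bin_central // -natrM natr1 -!natrM mul2n nm.
  have := mul_bin_down m.*2.+1 m; rewrite /= => ->.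
  by congr ((_ * _)%N%:R); rewrite -addnn; lia.
have QE : 2%:R ^+ p.-1 = 4%:R * ((- 4%:R : R) ^+ m * (- 4%:R) ^+ m) :> R.
  rewrite pE nm /= -[m.*2.+1.*2]muln2 mulnC exprM expr2 -natrM exprS -mul2n exprM.
  by rewrite -exprMn expr2; congr (_ * _ ^+ _); ring.
have := pow2_fermat; set Q := 2%:R ^+ p.-1 in QE * => PQ.
have QU : Q \is a GRing.unit by rewrite unitrX // natR2_unit.
have QQ := mul_ann_char PQ PQ.
have mE : 4%:R * m.+1%:R = P + 1 :> R by rewrite PE nm -mul2n; ring.
(* [Q - 1 - P] is a multiple of [p], so its square vanishes; this reads
   [Q (2P + 2 - Q) = (P + 1)^2]. *)
have key : 4%:R * c ^+ 2 = (2%:R * P + 2%:R - Q) * 'C(n, m)%:R ^+ 2.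
  apply: (mulrI QU).
  transitivity ((4%:R * (c * (- 4%:R) ^+ m)) ^+ 2); first by rewrite QE; ring.
  rewrite c4; transitivity ((4%:R * m.+1%:R) ^+ 2 * 'C(n, m)%:R ^+ 2 : R); first by ring.
  rewrite mE; apply/eqP; rewrite -subr_eq0; apply/eqP.
  transitivity ((P * P + (Q - 1) * (Q - 1) - 2%:R * (P * (Q - 1))) * 'C(n, m)%:R ^+ 2).
    by ring.
  by rewrite charP2 QQ PQ; ring.
rewrite val; transitivity (2%:R * (4%:R * c ^+ 2) + 4%:R * P); first by ring.
by rewrite key; ring.
Qed.

Lemma odd_reduces (m : nat) : n = m.*2.+1 ->
  reduces (R1 p / 2 + p%:R) (Tsum ^+ 2 + 8%:R * Usum ^+ 2).
Proof.
move=> nm; have p4 : (p %/ 4 = m)%N by rewrite pE nm -!addnn; lia.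
have U4 : 4%:R \is a @GRing.unit R by rewrite (_ : 4%:R = 2%:R ^+ 2) ?unitrX ?natR2_unit //; ring.
have cp2 : coprime p `|2%:Z| by rewrite coprimen2 pE /= odd_double.
have -> : Tsum ^+ 2 + 8%:R * Usum ^+ 2
   = (2%:R * P + 2%:R - 2%:R ^+ p.-1) * 'C(n, m)%:R ^+ 2 * (2%:~R)^-1 + P.
  apply: (mulrI U4); rewrite (odd_value nm).
  set c := _ - _; set d := _ ^+ 2.
  transitivity (2%:R * c * d * (2%:~R / 2%:~R) + 4%:R * P); last by ring.
  by rewrite divrr ?natR2_unit // mulr1.
rewrite /R1 p4; have -> : p.-1./2 = n by rewrite pE /= doubleK.
apply: reducesD; last exact: reduces_nat.
apply: reducesM; last exact: reducesV cp2.
apply: reducesM; last by apply: reducesX; apply: reduces_nat.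
apply: reducesD; last by apply: reducesN; apply: reducesX; apply: reduces_nat.
apply: reducesD; last exact: reduces_nat.
by apply: reducesM; apply: reduces_nat.
Qed.

(** For even [n], [Tsum] is a unit, so both sides may be multiplied by [2 Tsum^2]; then [Usum]
    enters only through [4 Tsum Usum = p - Tsum^2]. *)
Lemma even_value (m : nat) (x y : R) : n = m.*2 -> P = x ^+ 2 + 4%:R * y ^+ 2 ->
  4%:R * x ^+ 2 = Tsum ^+ 2 + 2%:R * P ->
  Tsum ^+ 2 + 8%:R * Usum ^+ 2 = - 24%:R * y ^+ 2 + 2%:R * P.
Proof.
move=> nm pxy x4; have TU : Tsum \is a GRing.unit.
  rewrite (Tsum_even nm) unitrM unitrX ?unitrN ?unitr1 //=.
  have mn : (m <= n)%N by rewrite nm -addnn; lia.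
  have aU : mhalf_bin m * (- 4%:R) ^+ m \is a GRing.unit.
    by rewrite mhalf_bin_central //; apply: bin_unit; rewrite pE nm -addnn; lia.
  by move: aU; rewrite unitrM => /andP[].
have sn : (-1) ^+ n = 1 :> R by rewrite -signr_odd nm odd_double.
have := Tsum_Usum; rewrite sn mul1r => L.
apply: (mulrI natR2_unit); apply: (mulIr TU); apply: (mulIr TU).
transitivity (2%:R * Tsum ^+ 4 + (Tsum * (Tsum + 4%:R * Usum) - Tsum ^+ 2) ^+ 2); first by ring.
rewrite L; transitivity (3%:R * Tsum ^+ 4 - 2%:R * P * Tsum ^+ 2 + P * P); first by ring.
rewrite charP2; transitivity ((3%:R * (Tsum ^+ 2 + 2%:R * P) - 8%:R * P) * Tsum ^+ 2); first by ring.
by rewrite -x4 pxy; ring.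
Qed.

(** * Teichmueller representatives modulo [p^2] *)

Local Notation F := 'F_p.

(* [u] is an element of Z/p^2 whose residue class mod p is [x]. *)
Definition lifts (x : F) (u : R) : Prop :=
  exists k : nat, x = k%:R /\ P * (u - k%:R) = 0.

Lemma lifts_nat (k : nat) : lifts k%:R k%:R.
Proof. by exists k; rewrite subrr mulr0. Qed.

Lemma liftsD (x y : F) (u v : R) : lifts x u -> lifts y v -> lifts (x + y) (u + v).
Proof.
move=> [k [-> hk]] [l [-> hl]]; exists (k + l)%N; rewrite natrD; split=> //.
transitivity (P * (u - k%:R) + P * (v - l%:R)); first by rewrite natrD; ring.
by rewrite hk hl addr0.
Qed.

Lemma liftsM (x y : F) (u v : R) : lifts x u -> lifts y v -> lifts (x * y) (u * v).
Proof.
move=> [k [-> hk]] [l [-> hl]]; exists (k * l)%N; rewrite natrM; split=> //.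
transitivity (P * (u - k%:R) * v + k%:R * (P * (v - l%:R))); first by rewrite natrM; ring.
by rewrite hk hl; ring.
Qed.

Lemma liftsX (x : F) (u : R) (k : nat) : lifts x u -> lifts (x ^+ k) (u ^+ k).
Proof.
move=> xu; elim: k => [|k IH]; first exact: (lifts_nat 1).
by rewrite !exprS; apply: liftsM.
Qed.

Lemma liftsN1 : lifts (-1) (-1).
Proof.
exists p.-1; have e (S : pzRingType) : p.-1%:R = p%:R - 1 :> S.
  by rewrite -subn1 natrB // prime_gt0.
rewrite !e; split.
  by have /eqP -> : (p%:R : F) == 0; rewrite ?(Fp_natr_eq0 p_pr) ?sub0r.
by transitivity (- (P * P)); [ring|rewrite charP2 oppr0].
Qed.

Lemma liftsB (x y : F) (u v : R) : lifts x u -> lifts y v -> lifts (x - y) (u - v).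
Proof.
by move=> xu yv; rewrite -mulN1r -[- v]mulN1r; apply: liftsD => //; apply: liftsM liftsN1 _.
Qed.

Lemma lifts_inj (x : F) (u v : R) : lifts x u -> lifts x v -> P * (u - v) = 0.
Proof.
move=> [k [-> hk]] [l [e hl]]; have kl : P * (k%:R - l%:R) = 0.
  apply: natR_mod; by have := congr1 (@nat_of_ord _) e; rewrite !val_Fp_nat.
transitivity (P * (u - k%:R) - P * (v - l%:R) + P * (k%:R - l%:R)); first by ring.
by rewrite hk hl kl; ring.
Qed.

Lemma lifts_unit (x : F) (u : R) : lifts x u -> x != 0 -> u \is a GRing.unit.
Proof.
move=> [k [-> hk]]; rewrite (Fp_natr_eq0 p_pr) -prime_coprime // => kU.
exact: unit_ann_char hk (natR_unit kU).
Qed.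

(** In [u^p - v^p = (u - v) (sum of p terms)], the first factor is 0 modulo [p], and so is the
    second, its [p] terms being all congruent to [u^(p-1)]. *)
Lemma lifts_exp_p (x : F) (u v : R) : lifts x u -> lifts x v -> u ^+ p = v ^+ p.
Proof.
move=> xu xv; apply/eqP; rewrite -subr_eq0 subrXX; apply/eqP.
apply: mul_ann_char; first exact: lifts_inj xu xv.
rewrite mulr_sumr (eq_bigr (fun _ => P * u ^+ p.-1)) => [|i _].
  rewrite sumr_const card_ord; transitivity (P * P * u ^+ p.-1); first by ring.
  by rewrite charP2 mul0r.
have -> : u ^+ p.-1 = u ^+ (p.-1 - i) * u ^+ i.
  by rewrite -exprD subnK // -ltnS prednK // prime_gt0.
have e := lifts_inj (liftsX i xu) (liftsX i xv).
apply/eqP; rewrite eq_sym -subr_eq0; apply/eqP.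
transitivity (u ^+ (p.-1 - i) * (P * (u ^+ i - v ^+ i))); first by ring.
by rewrite e mulr0.
Qed.

Definition teich (x : F) : R := (nat_of_ord x)%:R ^+ p.

Lemma teich_lifts_exp (x : F) (u : R) : lifts x u -> teich x = u ^+ p.
Proof.
by apply: lifts_exp_p; rewrite -{1}[x]natr_Zp; apply: lifts_nat.
Qed.

Lemma lifts_teich (x : F) : lifts x (teich x).
Proof.
rewrite -{1}[x]natr_Zp; set k := nat_of_ord x; exists k; split=> //.
by rewrite /teich -/k -natrX; apply: natR_mod; apply: fermat_little.
Qed.

Lemma teichM (x y : F) : teich (x * y) = teich x * teich y.
Proof.
have lx (w : F) : lifts w (nat_of_ord w)%:R by rewrite -{1}[w]natr_Zp; apply: lifts_nat.
by rewrite (teich_lifts_exp (liftsM (lx x) (lx y))) exprMn.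
Qed.

Lemma teich0 : teich 0 = 0.
Proof. by rewrite (teich_lifts_exp (lifts_nat 0)) expr0n eqn0Ngt prime_gt0. Qed.

Lemma teich_half (x : F) : teich x ^+ n = (legendre n x)%:~R.
Proof.
have [->|x0] := eqVneq x 0.
  by rewrite teich0 expr0n legendre0 eqn0Ngt (half_gt0 p_pr pE).
have lx : lifts x (nat_of_ord x)%:R by rewrite -{1}[x]natr_Zp; apply: lifts_nat.
have l1 : lifts (legendre n x)%:~R (legendre n x)%:~R.
  case: (legendre_cases n x0) => -> /=; first exact: (lifts_nat 1).
  exact: liftsN1.
have xn : x ^+ n = (legendre n x)%:~R by case: (legendre_exp p_pr pE x0) => -[-> ->].
rewrite /teich -exprM mulnC exprM.
have ln := liftsX n lx; rewrite xn in ln.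
rewrite (lifts_exp_p ln l1).
case: (legendre_cases n x0) => -> /=; first by rewrite expr1n.
by rewrite -signr_odd pE /= odd_double expr1.
Qed.

(* Newton's step for [r ^ 2 = 1] starting from [u ^ n], which determines the
   Legendre symbol mod p^2 by a polynomial in [u] of degree [3 n]. *)
Lemma newton_legendre (x : F) (u : R) : (1 < n)%N -> lifts x u ->
  3%:R * u ^+ n - u ^+ (3 * n) = 2%:R * (legendre n x)%:~R.
Proof.
move=> n1 xu; have [x0|x0] := eqVneq x 0.
  have Pu : P * u = 0.
    have xu0 : lifts 0 u by rewrite -x0.
    by have := lifts_inj xu0 (lifts_nat 0); rewrite subr0.
  have uu : u ^+ n = 0.
    by rewrite -(subnKC n1) exprD expr2 (mul_ann_char Pu Pu) mul0r.
  by rewrite mulnC exprM uu x0 legendre0; ring.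
have l1 : lifts (legendre n x)%:~R (legendre n x)%:~R.
  case: (legendre_cases n x0) => -> /=; first exact: (lifts_nat 1).
  exact: liftsN1.
have xn : x ^+ n = (legendre n x)%:~R by case: (legendre_exp p_pr pE x0) => -[-> ->].
have ln := liftsX n xu; rewrite xn in ln.
have d0 := lifts_inj ln l1; have dd := mul_ann_char d0 d0.
rewrite mulnC exprM; move: dd; set v := u ^+ n.
have r2 : (legendre n x)%:~R * (legendre n x)%:~R = 1 :> R.
  by case: (legendre_cases n x0) => ->; ring.
move: r2; set r := (legendre n x)%:~R : R => r2 dd.
transitivity (3%:R * v - (r * r) * r - 3%:R * (r * r) * (v - r)
   - ((v - r) * (v - r)) * (v + 2%:R * r)); first by ring.
by rewrite r2 dd; ring.
Qed.

(** Multiplying [x] by a primitive root [z] scales the sum by [teich z ^+ j], which differs from 1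
    by a unit unless [2n] divides [j]. *)
Lemma sum_teich_exp (j : nat) : (0 < j)%N ->
  \sum_x teich x ^+ j = if (n.*2 %| j)%N then n.*2%:R else 0.
Proof.
move=> j0; have [z zP] := Fp_primitive_root p_pr pE.
have zj0 : z != 0.
  apply/eqP => z0; have := prim_expr_order zP; rewrite z0 expr0n double_eq0.
  by rewrite eqn0Ngt (half_gt0 p_pr pE) => /eqP; rewrite eq_sym oner_eq0.
case: ifP => [/dvdnP[i ji]|ndv].
  rewrite (bigD1 0) //= teich0 expr0n eqn0Ngt.
  rewrite j0 add0r (eq_bigr (fun _ => 1)) => [|x x0].
    rewrite sumr_const (eq_card (B := predC1 (0 : F))) // cardC1 card_Fp //.
    by rewrite pE.
  rewrite ji mulnC -muln2 -mulnA exprM teich_half exprM expr2.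
  by case: (legendre_cases n x0) => ->; rewrite ?mulrNN mulr1 expr1n.
have e : \sum_x teich x ^+ j = teich z ^+ j * \sum_x teich x ^+ j.
  rewrite {1}(reindex_inj (mulfI zj0)) mulr_sumr; apply: eq_bigr => x _ /=.
  by rewrite teichM exprMn.
have U : teich z ^+ j - 1 \is a GRing.unit.
  apply: (@lifts_unit (z ^+ j - 1)).
    by apply: liftsB (lifts_nat 1); apply: liftsX; apply: lifts_teich.
  by rewrite subr_eq0 -(prim_order_dvd zP) ndv.
by apply: (mulrI U); rewrite mulr0 mulrBl mul1r -e subrr.
Qed.

(** * The Jacobsthal sum modulo [p^2] for [p = 4m + 1] *)

Section Quartic.
Variable m : nat.
Hypothesis nm : n = m.*2.

Let m_gt0 : (0 < m)%N.
Proof. by have := half_gt0 p_pr pE; rewrite nm double_gt0. Qed.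

Let n_even : ~~ odd n.
Proof. by rewrite nm odd_double. Qed.

Lemma sum_residue_class (V : nmodType) (c : nat) (E : nat -> V) :
  \sum_(k < (c * n).+1) (if (n %| m + k)%N then E k else 0)
  = \sum_(j < c) E (j * n + m)%N.
Proof.
have mn : (m < n)%N by rewrite nm -addnn -[X in (X < _)%N]addn0 ltn_add2l.
have n0 : (0 < n)%N by apply: leq_ltn_trans mn.
rewrite big_ord_recr /= dvdn_addl ?dvdn_mull // gtnNdvd // addr0.
elim: c => [|c IH]; first by rewrite !big_ord0.
rewrite big_ord_recr /= -IH mulSnr big_split_ord /=; congr (_ + _).
rewrite (bigD1 (Ordinal mn)) //= big1 ?addr0 => [|i im].
  by rewrite addnCA dvdn_addr ?dvdn_mull // addnn -nm dvdnn.
rewrite addnCA dvdn_addr ?dvdn_mull //; case: ifP => // /dvdnP[q e].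
case/eqP: im; apply: val_inj => /=; have := ltn_ord i.
case: q e => [|[|q]] e; nia.
Qed.

(** Expand by the binomial theorem: the exponent [n + 2k = 2 (m + k)] is divisible by [2n] exactly
    when [k = j n + m], and [(-1)^k = (-1)^m] since [n] is even. *)
Lemma sum_teich_binomial (c : nat) : (0 < c)%N ->
  \sum_x teich x ^+ n * (1 - teich x ^+ 2) ^+ (c * n)
  = (P - 1) * (-1) ^+ m * \sum_(j < c) 'C(c * n, j * n + m)%:R.
Proof.
move=> c0; have n0 := half_gt0 p_pr pE.
transitivity (\sum_x \sum_(k < (c * n).+1)
    (-1) ^+ k * 'C(c * n, k)%:R * teich x ^+ (n + 2 * k)).
  apply: eq_bigr => x _; rewrite addrC exprD1n mulr_sumr; apply: eq_bigr => k _.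
  rewrite (exprNn (teich x ^+ 2)) exprD (exprM _ 2 k) -mulr_natr.
  set t := (_ ^+ 2) ^+ k; set s := (-1) ^+ k; set v := teich x ^+ n; ring.
rewrite exchange_big /= mulr_sumr.
pose E k : R := (P - 1) * (-1) ^+ k * 'C(c * n, k)%:R.
transitivity (\sum_(k < (c * n).+1) (if (n %| m + k)%N then E k else 0)).
  apply: eq_bigr => k _; rewrite -mulr_sumr sum_teich_exp ?addn_gt0 ?n0 //.
  have -> : (n + 2 * k = 2 * (m + k))%N by move: nm; rewrite -addnn; lia.
  have -> : n.*2%:R = P - 1 :> R by rewrite natR_p -mul2n natrM; ring.
  by rewrite -mul2n dvdn_pmul2l //; case: ifP => _; rewrite /E; ring.
rewrite sum_residue_class; apply: eq_bigr => j _; rewrite /E; congr (_ * _ * _).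
by rewrite -signr_odd oddD oddM (negPf n_even) andbF signr_odd.
Qed.

(** [newton_legendre] at [1 - teich x ^+ 2] produces the sums of [sum_teich_binomial] with [c = 1]
    and [c = 3]. *)
Lemma jacobsthal_mod :
  2%:R * (@jacobsthal p n 1)%:~R = (P - 1) * (-1) ^+ m *
    (3%:R * 'C(n, m)%:R - 2%:R * 'C(3 * n, m)%:R - 'C(3 * n, n + m)%:R) :> R.
Proof.
have n1 : (1 < n)%N by rewrite nm -addnn; move: m_gt0; lia.
have h1 := @sum_teich_binomial 1 isT; have h3 := @sum_teich_binomial 3 isT.
have s1 (f : nat -> R) : \sum_(j < 1) f j = f 0 by rewrite big_ord1.
have s3 (f : nat -> R) : \sum_(j < 3) f j = f 0 + f 1 + f 2.
  by rewrite !big_ord_recr big_ord0 /= add0r.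
rewrite (s1 (fun j => 'C(1 * n, j * n + m)%:R)) mul0n add0n mul1n in h1.
rewrite (s3 (fun j => 'C(3 * n, j * n + m)%:R)) mul0n add0n mul1n in h3.
have e : 'C(3 * n, 2 * n + m) = 'C(3 * n, m).
  by rewrite -bin_sub ?nm -?addnn; [congr 'C(_, _)|]; lia.
rewrite e in h3.
rewrite /jacobsthal rmorph_sum mulr_sumr.
transitivity (3%:R * (\sum_x teich x ^+ n * (1 - teich x ^+ 2) ^+ n)
  - \sum_x teich x ^+ n * (1 - teich x ^+ 2) ^+ (3 * n)).
  rewrite mulr_sumr -sumrB; apply: eq_bigr => x _ /=.
  have lx : lifts (1 - x ^+ 2) (1 - teich x ^+ 2).
    by apply: liftsB (lifts_nat 1) _; apply: liftsX; apply: lifts_teich.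
  rewrite -(legendreN p_pr pE n_even (x ^+ 2 - 1)) opprB intrM -teich_half.
  transitivity (teich x ^+ n * (2%:R * (legendre n (1 - x ^+ 2))%:~R)); first by ring.
  by rewrite -(newton_legendre n1 lx); ring.
by rewrite h1 h3; ring.
Qed.

Lemma fact_bin_prod (N k : nat) :
  k`!%:R * 'C(N, k)%:R = \prod_(i < k) (N%:R - i%:R) :> R.
Proof.
elim: k => [|k IH]; first by rewrite big_ord0 bin0 mulr1.
rewrite big_ord_recr /= -IH factS natrM mulrAC -mulrA.
transitivity (k`!%:R * (k.+1%:R * 'C(N, k.+1)%:R) : R); first by ring.
by rewrite natr_binS; ring.
Qed.

Lemma prod_taylor (z : R) (k : nat) : exists D : R, forall s : R,
  \prod_(i < k) (z + P * s - i%:R) = \prod_(i < k) (z - i%:R) + P * s * D.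
Proof.
elim: k => [|k [D hD]]; first by exists 0 => s; rewrite !big_ord0; ring.
exists (D * (z - k%:R) + \prod_(i < k) (z - i%:R)) => s.
rewrite !big_ord_recr /= hD; set A := \prod_(i < k) _.
transitivity ((A + P * s * D) * (z - k%:R) + P * s * A + (P * P) * s ^+ 2 * D).
  by ring.
by rewrite charP2; ring.
Qed.

(* To first order in [p], ['C(z, m)] at [z = n - 1], [n - 1 + p] and [n - 1 - p / 2]
   (the last one is [-3/2]) is affine in [z]. *)
Lemma middle_bin :
  (1 - P) * (3%:R * 'C(n, m)%:R - 2%:R * 'C(3 * n, m)%:R) = 2%:R * mhalf_bin m.
Proof.
have n1 : n.-1.+1 = n by rewrite prednK // (half_gt0 p_pr pE).
have eX : 'C(n, m) = (2 * 'C(n.-1, m))%N.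
  have := mul_bin_down n m; rewrite {1 3}nm -addnn addnK => e.
  by apply/eqP; rewrite -(eqn_pmul2l m_gt0) -e; apply/eqP; ring.
have [D hD] := prod_taylor n.-1%:R m.
have n1R : n.-1%:R = n%:R - 1 :> R by rewrite -[in RHS]n1 -natr1 addrK.
have hX := fact_bin_prod n.-1 m.
have hY : m`!%:R * 'C(3 * n, m)%:R = m`!%:R * 'C(n.-1, m)%:R + P * D :> R.
  rewrite fact_bin_prod hX; have := hD 1; rewrite !mulr1 => <-.
  by apply: eq_bigr => i _; rewrite n1R natR_p natrM; ring.
have b0 : (0 < halfsq)%N.
  by have := halfsqE; have := prime_gt1 p_pr; case: halfsq => // p1; nia.
have b1 : halfsq.-1%:R = halfsq%:R - 1 :> R by rewrite -[in RHS](prednK b0) -natr1 addrK.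
have b2 := halfsqR; have two : 2%:R / 2%:R = 1 :> R by rewrite divrr // natR2_unit.
have hW : 2%:R * (m`!%:R * ((2%:R * m%:R + 1) * mhalf_bin m))
    = 2%:R * (m`!%:R * 'C(n.-1, m)%:R) - P * D.
  rewrite -mhalf_bin_pred fact_bin_prod hX.
  have -> : \prod_(i < m) (halfsq.-1%:R - i%:R) = \prod_(i < m) (n.-1%:R + P * (- 2%:R^-1) - i%:R).
    apply: eq_bigr => i _; congr (_ - _); apply: (mulrI natR2_unit).
    rewrite b1 n1R; transitivity (2%:R * halfsq%:R - 2%:R : R); first by ring.
    rewrite b2; transitivity (2%:R * n%:R - 2%:R - P * (2%:R / 2%:R)); last by ring.
    by rewrite two natR_p; ring.
  rewrite hD; set A := \prod_(i < m) _.
  transitivity (2%:R * A - (2%:R / 2%:R) * (P * D)); first by ring.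
  by rewrite two; ring.
have mU : m`!%:R \is a @GRing.unit R.
  by apply: fact_unit; rewrite pE nm -!addnn; lia.
apply: (mulrI mU); rewrite eX natrM.
transitivity ((1 - P) * (6%:R * (m`!%:R * 'C(n.-1, m)%:R) - 2%:R * (m`!%:R * 'C(3 * n, m)%:R))).
  by ring.
rewrite hY; transitivity ((1 - P) * 2%:R * (2%:R * (m`!%:R * 'C(n.-1, m)%:R) - P * D)).
  by ring.
rewrite -hW; transitivity ((1 - P) * (4%:R * m%:R + 2%:R) * (2%:R * (m`!%:R * mhalf_bin m))).
  by ring.
(* This cancels the factor [1 - P], since [(1 - P)(1 + P) = 1]. *)
have -> : 4%:R * m%:R + 2%:R = 1 + P by rewrite natR_p nm -mul2n natrM; ring.
transitivity ((1 - P * P) * (2%:R * (m`!%:R * mhalf_bin m))); first by ring.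
by rewrite charP2; ring.
Qed.

(** The factor [p] of [(p + k)!] lets the factors [p + i] be reduced to [i]. *)
Lemma fact_add_p (k : nat) : (p + k)`!%:R = P * (p.-1)`!%:R * k`!%:R :> R.
Proof.
elim: k => [|k IH].
  by rewrite addn0 -{1}(prednK (prime_gt0 p_pr)) factS prednK ?prime_gt0 // natrM mulr1.
rewrite addnS !factS !natrM IH -addnS natrD.
transitivity (P * P * (p.-1)`!%:R * k`!%:R + P * (p.-1)`!%:R * (k.+1%:R * k`!%:R)); first by ring.
by rewrite charP2 mul0r mul0r add0r.
Qed.

(** Wilson's theorem for [k = 0]; moving one factor between the factorials changes the sign, as
    [p - (k+1)] is [-(k+1)] modulo [p]. *)
Lemma wilson_split (k : nat) : (k < p)%N ->
  P * (k`!%:R * (p.-1 - k)`!%:R) = P * - (-1) ^+ k.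
Proof.
elim: k => [|k IH] kp.
  rewrite subn0 mul1r expr0; have : (p.-1)`! = p.-1 %[mod p].
    have := prime_gt1 p_pr => p1.
    have /dvdnP[d e] : (p %| ((p.-1)`!).+1)%N by rewrite -Wilson.
    apply/eqP; rewrite -(eqn_modDr 1) !addn1 e prednK ?prime_gt0 //.
    by rewrite modnMl modnn.
  move=> /natR_mod e; apply/eqP; rewrite -subr_eq0; apply/eqP.
  have p1 : p.-1%:R = P - 1 by rewrite -subn1 natrB // prime_gt0.
  transitivity (P * ((p.-1)`!%:R - p.-1%:R) + P * P); first by rewrite p1; ring.
  by rewrite e charP2 addr0.
have := IH (ltnW kp); have -> : (p.-1 - k = (p.-1 - k.+1).+1)%N by lia.
rewrite !factS !natrM => e.
have q : (p.-1 - k.+1).+1%:R = P - k.+1%:R.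
  by rewrite -natrB ?(ltnW kp) //; congr (_%:R); lia.
rewrite q in e.
rewrite [(-1) ^+ k.+1]exprS; transitivity (- (P * - (-1) ^+ k)); last by ring.
rewrite -e; apply/eqP; rewrite -subr_eq0; apply/eqP.
transitivity (P * P * (k`!%:R * (p.-1 - k.+1)`!%:R)); first by ring.
by rewrite charP2 mul0r.
Qed.

Let threen : (3 * n = p + n.-1)%N.
Proof. by rewrite pE -addnn; move: m_gt0; rewrite nm -addnn; lia. Qed.

Lemma fact_3n : (3 * n)`!%:R = 'C(3 * n, n + m)%:R * (n + m)`!%:R ^+ 2 :> R.
Proof.
have le : (n + m <= 3 * n)%N by rewrite nm -addnn; lia.
rewrite -(bin_fact le) !natrM expr2; congr (_ * (_ * _`!%:R)).
by rewrite nm -addnn; lia.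
Qed.

Lemma bin_3n_ann : P * 'C(3 * n, n + m)%:R = 0.
Proof.
have U : (n + m)`!%:R ^+ 2 \is a @GRing.unit R.
  by apply/unitrX/fact_unit; rewrite pE nm -!addnn; lia.
apply: (mulIr U); rewrite mul0r -mulrA -fact_3n threen fact_add_p.
by rewrite !mulrA charP2 !mul0r.
Qed.

(** The second factor is a multiple of [p], so [mhalf_bin m] may be replaced by [binom(n, m)]; the
    factorials in the product [X] are then evaluated by [wilson_split], giving [n X = p]. *)
Lemma mhalf_bin_bin_3n : mhalf_bin m * 'C(3 * n, n + m)%:R = - 2%:R * P.
Proof.
have mn : (m <= n)%N by rewrite nm -addnn leq_addr.
have [c hc] := ann_char bin_3n_ann.
have -> : mhalf_bin m * 'C(3 * n, n + m)%:R = 'C(n, m)%:R * 'C(3 * n, n + m)%:R.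
  have e := mhalf_bin_bin mn; apply/eqP; rewrite -subr_eq0 -mulrBl hc; apply/eqP.
  by transitivity (P * (mhalf_bin m - 'C(n, m)%:R) * c); [ring|rewrite e mul0r].
have w1 : P * (m`!%:R * (n + m)`!%:R) = P * - (-1) ^+ m.
  rewrite -wilson_split; last by rewrite pE nm -!addnn; lia.
  by congr (_ * (_ * _`!%:R)); rewrite pE nm -!addnn; lia.
have w2 : P * (n`!%:R * n`!%:R) = - P.
  have -> : n`!%:R * n`!%:R = n`!%:R * (p.-1 - n)`!%:R :> R.
    by congr (_ * _`!%:R); rewrite pE -addnn; lia.
  rewrite wilson_split; last by rewrite pE -addnn; lia.
  by rewrite -signr_odd (negPf n_even); ring.
have w3 : P * (p.-1)`!%:R = - P.
  by have := wilson_split (prime_gt0 p_pr); rewrite subn0 mul1r expr0 mulrN mulr1.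
have f1 : n`!%:R = 'C(n, m)%:R * m`!%:R ^+ 2 :> R.
  rewrite -(bin_fact mn) !natrM expr2; congr (_ * (_ * _`!%:R)).
  by rewrite nm -addnn addnK.
have f3 := fact_3n; rewrite threen fact_add_p w3 -threen in f3.
have f2 : n`!%:R = n%:R * (n.-1)`!%:R :> R.
  by rewrite -natrM -[in LHS](prednK (half_gt0 p_pr pE)) factS prednK // (half_gt0 p_pr pE).
set X := _ * _; have PX : P * X = 0 by rewrite /X mulrCA bin_3n_ann mulr0.
have Xw : X * (m`!%:R * (n + m)`!%:R) ^+ 2 = X.
  rewrite /X hc; transitivity ('C(n, m)%:R * c * (P * (m`!%:R * (n + m)`!%:R)) * (m`!%:R * (n + m)`!%:R)).
    by ring.
  rewrite w1; transitivity ('C(n, m)%:R * c * - (-1) ^+ m * (P * (m`!%:R * (n + m)`!%:R))).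
    by ring.
  rewrite w1; have := sqrr_sign R m; set s := (-1) ^+ m => s2.
  by transitivity ('C(n, m)%:R * (P * c) * s ^+ 2); [ring|rewrite s2 mulr1].
have nX : n%:R * X = P.
  rewrite -Xw /X; transitivity (n%:R * (('C(n, m)%:R * m`!%:R ^+ 2)
    * ('C(3 * n, n + m)%:R * (n + m)`!%:R ^+ 2)) : R).
    by ring.
  rewrite -f1 -f3; transitivity (- (P * (n`!%:R * (n%:R * (n.-1)`!%:R)))); first by ring.
  by rewrite -f2 w2 opprK.
(* [P * X = 0] with [p = 2n + 1] means [X = -2 n X]. *)
transitivity (P * X - 2%:R * (n%:R * X)); first by rewrite natR_p; ring.
by rewrite PX nX; ring.
Qed.

(** By [middle_bin], [2 J] is [2 mhalf_bin m - c] up to sign, with [c^2 = 0] and cross term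
    [-4 c (mhalf_bin m) = 8p]. *)
Lemma jacobsthal_sqr_mod :
  (@jacobsthal p n 1)%:~R ^+ 2 = Tsum ^+ 2 + 2%:R * P :> R.
Proof.
have e := jacobsthal_mod; have h := middle_bin; have a := mhalf_bin_bin_3n.
have c0 := bin_3n_ann; have cc := mul_ann_char c0 c0.
rewrite (Tsum_even nm); have := sqrr_sign R m; move: e.
set s := (-1) ^+ m; set J := (@jacobsthal p n 1)%:~R : R; set c := 'C(3 * n, n + m)%:R in a c0 cc *.
set X := 3%:R * _ - _ => e s2.
have U : 2%:R * 2%:R \is a @GRing.unit R by rewrite unitrM natR2_unit.
apply: (mulrI U).
transitivity ((2%:R * J) ^+ 2); first by ring.
rewrite e; transitivity (s ^+ 2 * ((1 - P) * X - c + P * c) ^+ 2); first by ring.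
rewrite h c0 s2.
transitivity (4%:R * mhalf_bin m ^+ 2 - 4%:R * (mhalf_bin m * c) + c * c); first by ring.
rewrite a cc; transitivity (4%:R * s ^+ 2 * mhalf_bin m ^+ 2 + 8%:R * P); last by ring.
by rewrite s2; ring.
Qed.

End Quartic.

End ModSquare.

(** * Uniqueness of the two squares and conclusion *)

Lemma Zp_natR_eq0 (q k : nat) : (1 < q)%N -> ((k%:R : 'Z_q) == 0) = (q %| k)%N.
Proof.
by move=> q1; rewrite -val_eqE /= val_Zp_nat.
Qed.

Lemma Zp_natR_surj (q : nat) (x : 'Z_q) : exists k : nat, x = k%:R.
Proof. by exists (val x); rewrite natr_Zp. Qed.

Lemma int_parity (x : int) : exists h : int, x = 2%:R * h \/ x = 2%:R * h + 1.
Proof. by exists (x %/ 2)%Z; lia. Qed.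

(** [p] divides [(2Ay - bx)(2Ay + bx) = p (A^2 - x^2)], hence one factor [2Ay - cx] with [c = b] or
    [c = -b]. As [p^2 = (Ax + 2cy)^2 + (2Ay - cx)^2], a nonzero factor would force [Ax + 2cy = 0],
    which is impossible for odd [A] and [x]. *)
Lemma two_squares_unique (p : nat) (a b x y : int) : prime p -> odd p ->
  (2%:R * a + 1) ^+ 2 + b ^+ 2 = p%:Z -> p%:Z = x ^+ 2 + 4%:R * y ^+ 2 ->
  (2%:R * a + 1) ^+ 2 = x ^+ 2.
Proof.
move=> p_pr p_odd eA ex; set A := 2%:R * a + 1 in eA *.
have p0 : p%:Z != 0 by rewrite -[0]/(0%:Z) eqz_nat -lt0n prime_gt0.
have [h hx] : exists h : int, x = 2%:R * h + 1.
  have [h [hx|hx]] := int_parity x; last by exists h.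
  exfalso; have : 2%:R * (2%:R * h ^+ 2 + 2%:R * y ^+ 2 - p./2%:Z) = 1.
    have := ex; rewrite -{1}(odd_double_half p) p_odd /= -muln2 PoszD PoszM hx => e.
    by transitivity (x ^+ 2 + 4%:R * y ^+ 2 - 2%:R * p./2%:Z); [rewrite hx; ring|rewrite hx -e; ring].
  by move: (_ - p./2%:Z) => w; clear; lia.
have main (c : int) : c ^+ 2 = b ^+ 2 -> (p %| 2%:R * A * y - c * x)%Z -> A ^+ 2 = x ^+ 2.
  move=> cb /dvdzP[k hk].
  have id : (A * x + 2%:R * c * y) ^+ 2 + (k * p%:Z) ^+ 2 = p%:Z ^+ 2.
    rewrite -hk -[RHS]mulr1 expr2; transitivity ((A ^+ 2 + c ^+ 2) * (x ^+ 2 + 4%:R * y ^+ 2)).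
      by ring.
    by rewrite cb eA -ex mulr1.
  have [k0|k0] := eqVneq k 0.
    have e : 2%:R * A * y = c * x by apply/eqP; rewrite -subr_eq0 hk k0 mul0r.
    apply: (mulfI p0); rewrite {1}ex -eA -cb.
    transitivity (A ^+ 2 * x ^+ 2 + (2%:R * A * y) ^+ 2); first by ring.
    by rewrite e; ring.
  have k1 : 1 <= k ^+ 2 by rewrite -gtz0_ge1 exprn_even_gt0.
  have p2 : 0 < p%:Z ^+ 2 by rewrite exprn_even_gt0.
  have z0 : A * x + 2%:R * c * y = 0.
    apply/eqP; rewrite -sqrf_eq0 eq_le sqr_ge0 andbT.
    have -> : (A * x + 2%:R * c * y) ^+ 2 = p%:Z ^+ 2 * (1 - k ^+ 2).
      by transitivity (p%:Z ^+ 2 - (k * p%:Z) ^+ 2); [rewrite -id; ring|ring].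
    by rewrite pmulr_rle0 // subr_le0.
  exfalso; have : 2%:R * (2%:R * a * h + a + h + c * y) + 1 = 0 by rewrite -z0 hx /A; ring.
  by move: (2%:R * a * h + a + h + c * y) => w; clear; lia.
have : (p%:Z %| (2%:R * A * y - b * x) * (2%:R * A * y - (- b) * x))%Z.
  apply/dvdzP; exists (A ^+ 2 - x ^+ 2).
  transitivity (A ^+ 2 * (4%:R * y ^+ 2) - b ^+ 2 * x ^+ 2); first by ring.
  have -> : 4%:R * y ^+ 2 = p%:Z - x ^+ 2 by rewrite ex; ring.
  have -> : b ^+ 2 = p%:Z - A ^+ 2 by rewrite -eA; ring.
  by ring.
rewrite dvdzE abszM Euclid_dvdM // => /orP[] d.
  by apply: (main b).
by apply: (main (- b)); rewrite ?sqrrN.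
Qed.

(** Dividing [jacobsthal_two_squares] by 4 writes [p] as an odd square plus a square; parity makes
    [jacobsthal n z] even, and uniqueness identifies the odd square with [x^2]. *)
Lemma jacobsthal_two_squares_repr (p n : nat) (x y : int) :
  prime p -> p = n.*2.+1 -> ~~ odd n -> p%:Z = x ^+ 2 + 4%:R * y ^+ 2 ->
  @jacobsthal p n 1 ^+ 2 = 4%:R * x ^+ 2.
Proof.
move=> p_pr pE n_even ex; have [z zP] := Fp_primitive_root p_pr pE.
have e := jacobsthal_two_squares p_pr pE zP n_even.
have [a ha] := jacobsthal_half p_pr pE zP n_even.
have [b hb] : exists b : int, jacobsthal n z = 2%:R * b.
  have [b [hb|hb]] := int_parity (jacobsthal n z).
  - by exists b.
  - exfalso; move: e; rewrite ha hb => e.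
    have : 4%:R * ((2%:R * a + 1) ^+ 2 + b ^+ 2 + b - p%:Z) + 1 = 0 :> int.
      by transitivity ((2%:R * (2%:R * a + 1)) ^+ 2 + (2%:R * b + 1) ^+ 2 - 4%:R * p%:R : int);
        [ring|rewrite e subrr].
    by move: (_ - p%:Z) => w; clear; lia.
have p_odd : odd p by rewrite pE /= odd_double.
have eA : (2%:R * a + 1) ^+ 2 + b ^+ 2 = p%:Z.
  have four : (4%:R : int) != 0 by [].
  by apply: (mulfI four); rewrite -[p%:Z]natz -e ha hb; ring.
by rewrite ha -(two_squares_unique p_pr p_odd eA ex); ring.
Qed.

Theorem theorem2p7 (p : nat) :
  prime p -> odd p ->
  (forall x y : int, (p %% 4 = 1)%N -> (p%:Z = x ^+ 2 + 4 * y ^+ 2) ->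
     rat_congr p 2 (S27 p) (- 24 * (y ^+ 2)%:~R + 2 * p%:R)) /\
  ((p %% 4 = 3)%N -> rat_congr p 2 (S27 p) (R1 p / 2 + p%:R)).
Proof.
move=> p_pr p_odd; pose n := p./2; pose R := 'Z_(p ^ 2).
have pE : p = n.*2.+1 by rewrite -[LHS]odd_double_half p_odd.
have p2 : (1 < p ^ 2)%N by rewrite -(exp1n 2) ltn_exp2r // prime_gt1.
have R0 (k : nat) : (k%:R == 0 :> R) = (p ^ 2 %| k)%N by apply: Zp_natR_eq0.
have Rs (x : R) : exists k : nat, x = k%:R by apply: Zp_natR_surj.
have S := S27_reduces p_pr pE R0.
split=> [x y p1 pxy|p3]; last first.
  have nm : n = (p %/ 4).*2.+1 by move: pE; rewrite -!addnn; lia.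
  exact: (reduces_congr p_pr R0 S (odd_reduces p_pr pE R0 Rs nm)).
have nm : n = (p %/ 4).*2 by move: pE; rewrite -!addnn; lia.
have n_even : ~~ odd n by rewrite nm odd_double.
have J := jacobsthal_two_squares_repr p_pr pE n_even pxy.
have JR := jacobsthal_sqr_mod p_pr pE R0 Rs nm.
have PR : p%:R = x%:~R ^+ 2 + 4%:R * y%:~R ^+ 2 :> R.
  have := congr1 (fun i : int => i%:~R : R) pxy.
  by rewrite intrD intrM !rmorphXn.
have XR : 4%:R * x%:~R ^+ 2 = Tsum R p n ^+ 2 + 2%:R * p%:R.
  rewrite -JR; have := congr1 (fun i : int => i%:~R : R) J.
  by rewrite intrM !rmorphXn => ->.
have V := even_value p_pr pE R0 Rs nm PR XR.
apply: (reduces_congr p_pr R0 S); rewrite V.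
apply: reducesD => //; last by apply: reducesM; apply: reduces_nat.
apply: reducesM; first by have := reduces_int R p (-24); congr reduces; ring.
by have := reduces_int R p (y ^+ 2); rewrite [in X in reduces _ _ X]rmorphXn.
Qed.
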